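(* Let $k\ge2$ and $1\le t<2^k-1$, and let $R$ and $Z$ be the numbers of ones and zeros in the $k$-bit word of $t$. Assume $R\ge Z\ge 2$, and suppose that $|S_{t,k}|\neq 2^{k-1}$. Then $$2^{k-1}-|S_{t,k}|\ge 2^{R-Z+1}.$$ Moreover, equality $2^{k-1}-|S_{t,k}|= 2^{R-Z+1}$ holds if and only if one of the following occurs: (i) exactly one cyclic gap has length $Z-2$, and all the remaining cyclic gaps have length at least $Z-1$; (ii) $Z=3$, exactly one cyclic gap has length $0$, and the other two cyclic gaps have length at least $2$.
   Context: For an integer $n\ge0$, $\operatorname{wt}(n)$ is the number of ones in its binary expansion. For $k\ge2$, $N=2^k-1$ and $1\le t\le N-1$, $$S_{t,k}=\{(a,b)\in\{0,\ldots,N-1\}^2: a+b\equiv t \pmod N,\ \operatorname{wt}(a)+\operatorname{wt}(b)<k\}.$$ The $k$-bit word of $t$ is its binary expansion padded with zeros to length $k$; it is regarded as a cyclic word (indices modulo $k$). The cyclic gaps are the $Z$ numbers $g_1,\dots,g_Z$ of ones lying strictly between cyclically consecutive zeros (possibly $0$); so $g_1+\cdots+g_Z=R$. *)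

(* Defs.v *)
From mathcomp Require Import all_boot.

Set Implicit Arguments.
Unset Strict Implicit.
Unset Printing Implicit Defensive.

Definition bit (n i : nat) : bool := odd (n %/ 2 ^ i).

(* The positions i >= n can be ignored since n < 2 ^ n. *)
Definition wt (n : nat) : nat := \sum_(i < n) bit n i.

Definition S_set (t k : nat) : {set 'I_(2 ^ k - 1) * 'I_(2 ^ k - 1)} :=
  [set ab : 'I_(2 ^ k - 1) * 'I_(2 ^ k - 1) |
    (ab.1 + ab.2 == t %[mod 2 ^ k - 1]) && (wt ab.1 + wt ab.2 < k)].

(* Least significant bit first. *)
Definition word (k t : nat) : seq bool := mkseq (bit t) k.

Definition ones (k t : nat) : nat := count id (word k t).
Definition zeros (k t : nat) : nat := count negb (word k t).

(* The zero at position i contributes the gap that follows it: in the rotated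
   word, which starts at the cyclic position i + 1, the index of the first zero
   is the number of ones strictly between position i and the next zero. The
   gaps are listed with multiplicity, one for each zero of the word. *)
Definition cyclic_gaps (w : seq bool) : seq nat :=
  [seq find negb (rot i.+1 w) | i <- iota 0 (size w) & ~~ nth true w i].

Definition gaps (k t : nat) : seq nat := cyclic_gaps (word k t).

(* Main.v *)
(* Read around the cyclic word of [t], the addition [a + b = t] modulo
   [2 ^ k - 1] is a closed walk of carries, so that [#|S|] is the sum of the
   coefficients of degree less than [k] of the trace of a product of 2 x 2
   transfer matrices in a variable [z] marking the weight.  A zero followed by
   [g] ones contributes the block [(2 z) ^ g runS x w g] with [x = z / 2] and
   [w = 2 z].  Let [c_j] be the coefficient of [w ^ j] in the trace of the
   product of these blocks, and [v_k = \sum_(j < k) (1 - x) ^ (k - 1 - j) c_j].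
   A telescoping sum gives
     [2 ^ (k - 1) - #|S| = 2 ^ (R - Z + 1) \sum_(0 < k < Z) 4 ^ (k - 1) E_k],
   where [E_k = 2 v_k[Z - k - 1] - v_k[Z - k]] is an integer.

   Substituting [(1 - x) w] for [w] turns [runS] into [(1 - x) runS = runT], whose
   derivative in [x] is a column times the row [(-1, w)].  Propagating this row
   through the product shows that [(Z - k + 1) v_k - (1 - x) v_k'] has nonnegative
   coefficients below degree [R - 1]; the coefficient of degree [Z - k - 1] is
   [(Z - k) E_k].  Hence [E_k >= 0].

   Equality means [E_1 = 1] and [E_k = 0] for [k > 1].  Here [(Z - 1) E_1] is a
   sum of numbers of lattice points on slices of boxes, whose lower bounds leave
   only (i), (ii) and the words with a single nonzero gap, for which [E_2 = 1].
   Conversely, if at most one gap is less than [Z - 1], then [x ^ (Z - 1)]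
   divides [c_j] for [j > 1], which forces [E_k = 0] for [k > 1]. *)

Require Import Defs.
From mathcomp Require Import all_boot all_order all_algebra.
From mathcomp Require Import ring zify.

Set Implicit Arguments.
Unset Strict Implicit.
Unset Printing Implicit Defensive.
Import Order.TTheory GRing.Theory Num.Theory.

(** * Binary words and cyclic gaps *)

Lemma sum_bit_widen n K L : n < 2 ^ K -> K <= L ->
  \sum_(i < L) bit n i = \sum_(i < K) bit n i.
Proof.
move=> hn hKL; rewrite (big_ord_widen _ (fun i => bit n i : nat) hKL) [RHS]big_mkcond /=.
apply: eq_bigr => i _; case: ltnP => // hi.
by rewrite /bit divn_small // (leq_trans hn) // leq_exp2l.
Qed.

Lemma wtE n K : n < 2 ^ K -> wt n = \sum_(i < K) bit n i.
Proof.
move=> hn; have hn' : n < 2 ^ n by apply: ltn_expl.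
by rewrite -(sum_bit_widen hn (leq_maxl K n)) (sum_bit_widen hn' (leq_maxr K n)).
Qed.

Lemma bit0 n : bit n 0 = odd n.
Proof. by rewrite /bit expn0 divn1. Qed.

Lemma bitS n i : bit n i.+1 = bit n./2 i.
Proof. by rewrite /bit expnS divnMA divn2. Qed.

Lemma wt_cons (b : bool) a : wt (b + a.*2) = b + wt a.
Proof.
have ha : a < 2 ^ a by apply: ltn_expl.
have hb : b + a.*2 < 2 ^ a.+1 by rewrite expnS; case: b; lia.
rewrite (wtE hb) big_ord_recl bit0 oddD oddb odd_double addbF (wtE ha).
congr (_ + _); apply: eq_bigr => i _; by rewrite bitS half_bit_double.
Qed.

Lemma wt_ones k : wt (2 ^ k - 1) = k.
Proof.
elim: k => [|k IH]; first by rewrite /wt big_ord0.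
have -> : 2 ^ k.+1 - 1 = true + (2 ^ k - 1).*2.
  by have h : 0 < 2 ^ k; [rewrite expn_gt0 | rewrite expnS /=; lia].
by rewrite wt_cons IH.
Qed.

Lemma word_cons k t : word k.+1 t = odd t :: word k t./2.
Proof.
rewrite /word /mkseq /= bit0 (iotaDl 1 0) -map_comp; congr cons.
by apply: eq_map => i /=; rewrite bitS.
Qed.

(** The word is read linearly: ones before the first zero are dropped, and a run not closed by a
    zero counts in full, because [find] returns the size when nothing is found. *)
Fixpoint lin_gaps (s : seq bool) : seq nat :=
  if s is b :: s' then
    if b then lin_gaps s' else find negb s' :: lin_gaps s'
  else [::].

Lemma lin_gapsK s :
  s = nseq (find negb s) true ++ flatten [seq false :: nseq g true | g <- lin_gaps s].
Proof. by elim: s => // -[] s {1}-> /=. Qed.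

Lemma size_lin_gaps s : size (lin_gaps s) = count negb s.
Proof. by elim: s => // -[] s /= ->. Qed.

Lemma sumn_lin_gaps s : (find negb s + sumn (lin_gaps s) = count id s)%N.
Proof. by elim: s => // -[] s /= <-. Qed.

Lemma lin_gapsE s : lin_gaps s =
  [seq find negb (drop i.+1 s) | i <- iota 0 (size s) & ~~ nth true s i].
Proof.
elim: s => // -[] s IH; rewrite /= (iotaDl 1 0) filter_map -map_comp.
  by rewrite IH.
by rewrite drop0 IH.
Qed.

(** Only the last run can wrap around, and the leading zero closes it at once, so the linear and the
    cyclic reading agree. *)
Lemma cyclic_gaps_lin s : cyclic_gaps (false :: s) = lin_gaps (false :: s).
Proof.
rewrite lin_gapsE; apply: eq_map => i; rewrite /rot find_cat /=.
by case: ifP => // /negbT /hasNfind ->; rewrite addn0.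
Qed.

(** If the first letter is a zero, its gap moves from the front of the list to the end; nothing else
    changes. *)
Lemma cyclic_gaps_rot1 w : perm_eq (cyclic_gaps (rot 1 w)) (cyclic_gaps w).
Proof.
case: w => // x s; set w := x :: s.
pose F := [seq find negb (rot i.+2 w) | i <- iota 0 (size s) & ~~ nth true s i].
pose h := if x then [::] else [:: find negb (rot 1 w)].
have -> : cyclic_gaps w = h ++ F.
  rewrite /cyclic_gaps [size w]/= [iota _ _]/= (iotaDl 1 0) {}/h {}/F {}/w.
  by case: x; rewrite /= filter_map -map_comp.
have -> : cyclic_gaps (rot 1 w) = F ++ h; last by rewrite perm_catC.
rewrite /cyclic_gaps size_rot -[size w]/(size s).+1 -[(size s).+1]addn1 iotaD add0n
  filter_cat map_cat.
congr (_ ++ _).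
  rewrite /F rot1_cons.
  transitivity [seq find negb (rot i.+1 (rot 1 w)) | i <- iota 0 (size s) & ~~ nth true s
    i].
    rewrite rot1_cons; congr map; apply: eq_in_filter => i.
    by rewrite mem_iota add0n => /andP[_ hi]; rewrite nth_rcons hi.
  apply/eq_in_map => i; rewrite mem_filter mem_iota add0n => /and3P[_ _ hi].
  by rewrite -rotD addn1.
rewrite {F}/h /= rot1_cons nth_rcons ltnn eqxx {}/w; case: x => //=.
by rewrite rot_oversize ?size_rcons.
Qed.

Lemma cyclic_gaps_rot r w : perm_eq (cyclic_gaps (rot r w)) (cyclic_gaps w).
Proof.
elim: r => [|r IH]; first by rewrite rot0.
case: (ltnP r (size w)) => h; last by rewrite rot_oversize // ltnW.
have -> : rot r.+1 w = rot 1 (rot r w) by rewrite -rotD ?add1n.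
exact: perm_trans (cyclic_gaps_rot1 _) IH.
Qed.

(** * Lattice points of boxes *)

(* The number of ways of writing [s] as an ordered sum of one term at most [g]
   for each [g] in [gs]. *)
Fixpoint box (gs : seq nat) (s : nat) : nat :=
  if gs is g :: gs' then \sum_(i < g.+1 | i <= s) box gs' (s - i) else s == 0.

Lemma box0 gs : box gs 0 = 1.
Proof.
elim: gs => //= g gs IH; rewrite (bigD1 ord0) //= IH big1 // => i.
by rewrite -val_eqE /=; lia.
Qed.

Lemma box_term g gs s i : i <= g -> i <= s -> box gs (s - i) <= box (g :: gs) s.
Proof. by move=> ig si; rewrite /= (bigD1 (Ordinal (ig : i < g.+1))) //= leq_addr. Qed.

Lemma box_term2 g gs s i j : i < j -> j <= g -> j <= s ->
  box gs (s - i) + box gs (s - j) <= box (g :: gs) s.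
Proof.
move=> ij jg js; have ig : i < g.+1 by lia.
rewrite /= (bigD1 (Ordinal ig)) /=; last by lia.
rewrite (bigD1 (Ordinal (jg : j < g.+1))) /=; first by rewrite leq_add2l leq_addr.
by rewrite js -val_eqE /=; lia.
Qed.

Lemma box_gt0 gs s : s <= sumn gs -> 0 < box gs s.
Proof.
elim: gs s => [|g gs IH] s /= hs; first by move: hs; rewrite leqn0 => ->.
case: (leqP g s) => h.
  by apply: leq_trans (box_term gs (leqnn g) h); apply: IH; lia.
by apply: leq_trans (box_term gs (ltnW h) (leqnn s)); rewrite subnn box0.
Qed.

Lemma count_pos_sumn gs : count (fun g => 0 < g) gs <= sumn gs.
Proof. by elim: gs => //= -[|g] gs /=; lia. Qed.

(** When the head is positive, two consecutive values of its term leave two slices of the tail: one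
    satisfies the bound for the tail and the other is nonempty, which accounts for the head. *)
Lemma box_ge gs s : 0 < s < sumn gs -> count (fun g => 0 < g) gs <= box gs s.
Proof.
elim: gs s => [|g gs IH] s hs; first by move: hs => /=; lia.
case: g hs => [|g] hs.
  apply: leq_trans (box_term gs (leqnn 0) (leq0n s)); rewrite subn0 /=.
  by apply: IH; move: hs => /=; lia.
have hs' : 0 < s < g.+1 + sumn gs by exact: hs.
rewrite [count _ _]/=.
have [gs0|gs0] := posnP (sumn gs).
  have -> : count (fun g => 0 < g) gs = 0 by have := count_pos_sumn gs; lia.
  by rewrite addn0; apply: (@box_gt0 (g.+1 :: gs)) => /=; lia.
case: (leqP s (sumn gs)) => h.
  have h0 : count (fun g => 0 < g) gs <= box gs s \/ count (fun g => 0 < g) gs <= box gs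
    (s - 1).
    case: (ltnP s (sumn gs)) => h1; first by left; apply: IH; lia.
    case: (ltnP 1 s) => h2; first by right; apply: IH; lia.
    left; have e1 : sumn gs = 1 by lia.
    have -> : s = 1 by lia.
    apply: leq_trans (box_gt0 _); last by rewrite e1.
    by have := count_pos_sumn gs; rewrite e1.
  have hb : 0 < box gs s by apply: box_gt0.
  have hb1 : 0 < box gs (s - 1) by apply: box_gt0; lia.
  have := @box_term2 g.+1 gs s 0 1 isT isT; rewrite subn0 => /(_ (proj1 (andP hs))); lia.
(* Here [s] exceeds the total [r] of the tail, so the head takes [s - r] or one more, leaving [r] or
   [r - 1]; the slice at [r - 1] carries the bound. *)
set r := sumn gs in gs0 h hs'.
have h2 := @box_term2 g.+1 gs s (s - r) (s - r).+1.
have e1 : s - (s - r) = r by lia.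
have e2 : s - (s - r).+1 = r.-1 by lia.
rewrite e1 e2 in h2.
have hb : 0 < box gs r by apply: box_gt0.
have hb1 : 0 < box gs r.-1 by apply: box_gt0; rewrite -/r; lia.
suff : count (fun g => 0 < g) gs <= box gs r.-1 by lia.
case: (ltnP 1 r) => hr; first by apply: IH; rewrite -/r; lia.
apply: leq_trans hb1.
by have := count_pos_sumn gs; rewrite -/r; lia.
Qed.

(** Every side is at least [s], so no upper bound on a term is active and stars and bars applies;
    the induction is the hockey-stick identity. *)
Lemma box_large g gs s : all (leq s) (g :: gs) ->
  box (g :: gs) s = 'C(s + size gs, s).
Proof.
elim: gs g s => [|h gs IH] g s.
  rewrite /= andbT => sg; rewrite addn0 binn.
  rewrite (bigD1 (Ordinal (sg : s < g.+1))) //= subnn big1 // => i.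
  by rewrite -val_eqE /=; case: eqP => //; lia.
move=> /andP[sg hgs]; rewrite [LHS]/=.
transitivity (\sum_(i < s.+1) box (h :: gs) (s - i)).
  rewrite (big_ord_widen g.+1 (fun i => box (h :: gs) (s - i))) //=.
transitivity (\sum_(i < s.+1) 'C(i + size gs, i)).
  rewrite (reindex_inj rev_ord_inj) /=; apply: eq_bigr => i _.
  have hi := ltn_ord i.
  have -> : s - (s.+1 - i.+1) = i by lia.
  apply: (IH h); have : all (leq s) (h :: gs) by exact: hgs.
  by apply: sub_all => x; apply: leq_trans; rewrite -ltnS.
rewrite /= addnS; elim: (s) => [|n IHn]; first by rewrite big_ord_recr big_ord0 /= !bin0.
by rewrite big_ord_recr /= IHn [RHS]binS addnC addSn.
Qed.

Local Open Scope ring_scope.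

(** * Transfer matrices of runs *)

Definition mx2 (K : Type) (a b c d : K) : 'M[K]_2 :=
  \matrix_(i < 2, j < 2)
    if i == 0 then if j == 0 then a else b else if j == 0 then c else d.

Lemma mx2_eta (K : Type) (M : 'M[K]_2) :
  M = mx2 (M 0 0) (M 0 1) (M 1 0) (M 1 1).
Proof.
apply/matrixP => i j; rewrite mxE.
by case: i j => [[|[|i]] // hi] [[|[|j]] // hj] /=; congr (M _ _); exact/val_inj.
Qed.

Lemma mx2E (K : Type) (a b c d : K) :
  (mx2 a b c d 0 0 = a) * (mx2 a b c d 0 1 = b) *
  (mx2 a b c d 1 0 = c) * (mx2 a b c d 1 1 = d).
Proof. by rewrite !mxE. Qed.

Lemma mulr2E (K : comNzRingType) (A B : 'M[K]_2) i j :
  (A * B) i j = A i 0 * B 0 j + A i 1 * B 1 j.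
Proof.
rewrite -mulmxE mxE !big_ord_recl big_ord0 addr0.
by congr (A _ _ * B _ _ + A _ _ * B _ _); apply/val_inj.
Qed.

Lemma mx2_1 (K : comNzRingType) : (1 : 'M[K]_2) = mx2 1 0 0 1.
Proof. by apply/matrixP=> -[[|[|i]] //hi] [[|[|j]] //hj]; rewrite !mxE. Qed.

Lemma mx2M (K : comNzRingType) (a b c d a' b' c' d' : K) :
  mx2 a b c d * mx2 a' b' c' d' =
  mx2 (a * a' + b * c') (a * b' + b * d') (c * a' + d * c') (c * b' + d * d').
Proof. by rewrite [LHS]mx2_eta !mulr2E !mx2E. Qed.

Lemma tr2E (K : comNzRingType) (M : 'M[K]_2) : \tr M = M 0 0 + M 1 1.
Proof.
rewrite /mxtrace !big_ord_recl big_ord0 addr0.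
by congr (_ + M _ _); apply/val_inj.
Qed.

Lemma map_mx2 (K K' : Type) (f : K -> K') (a b c d : K) :
  map_mx f (mx2 a b c d) = mx2 (f a) (f b) (f c) (f d).
Proof. by rewrite [LHS]mx2_eta !mxE. Qed.

Lemma scale_mx2 (K : comNzRingType) (u a b c d : K) :
  u *: mx2 a b c d = mx2 (u * a) (u * b) (u * c) (u * d).
Proof. by rewrite [LHS]mx2_eta !mxE. Qed.

Lemma trM2C (K : comNzRingType) (A B : 'M[K]_2) : \tr (A * B) = \tr (B * A).
Proof. exact: mxtrace_mulC. Qed.

Definition geo (K : nzRingType) (x : K) n := \sum_(i < n) x ^+ i.

Lemma geoS (K : nzRingType) (x : K) n : geo x n.+1 = geo x n + x ^+ n.
Proof. by rewrite /geo big_ord_recr. Qed.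

Lemma geo0 (K : nzRingType) (x : K) : geo x 0 = 0.
Proof. by rewrite /geo big_ord0. Qed.

Lemma geoE (K : comNzRingType) (x : K) n : (1 - x) * geo x n = 1 - x ^+ n.
Proof. by rewrite -[LHS]opprK -mulNr opprB -subrX1 opprB. Qed.

Definition runS (K : comNzRingType) (x w : K) g :=
  mx2 (geo x g.+1) (x ^+ g.+1 * w) (geo x g) (x ^+ g * w).

Definition runT (K : comNzRingType) (x w : K) g :=
  mx2 (1 - x ^+ g.+1) (x ^+ g.+1 * w) (1 - x ^+ g) (x ^+ g * w).

Lemma runTS (K : comNzRingType) (x w : K) g :
  runT x ((1 - x) * w) g = (1 - x) *: runS x w g.
Proof. by rewrite /runT /runS scale_mx2 !geoE; congr mx2; ring. Qed.

Lemma rmorph_geo (K K' : nzRingType) (f : {rmorphism K -> K'}) x n :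
  f (geo x n) = geo (f x) n.
Proof. by rewrite /geo rmorph_sum; apply: eq_bigr => i _; rewrite rmorphXn. Qed.

Lemma map_runS (K K' : comNzRingType) (f : {rmorphism K -> K'}) x w g :
  map_mx f (runS x w g) = runS (f x) (f w) g.
Proof. by rewrite /runS map_mx2 !rmorphM !rmorphXn !rmorph_geo. Qed.

Lemma map_runT (K K' : comNzRingType) (f : {rmorphism K -> K'}) x w g :
  map_mx f (runT x w g) = runT (f x) (f w) g.
Proof. by rewrite /runT map_mx2 !rmorphB !rmorphM !rmorphXn !rmorph1. Qed.

Lemma map_mx2_prod (K K' : comNzRingType) (f : {rmorphism K -> K'}) F (s : seq nat) :
  map_mx f (\prod_(g <- s) F g : 'M[K]_2) = \prod_(g <- s) map_mx f (F g).
Proof.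
elim: s => [|g s IH]; first by rewrite !big_nil map_mx1.
by rewrite !big_cons -IH -!mulmxE map_mxM.
Qed.

Definition trS (K : comNzRingType) (x w : K) gs := \tr (\prod_(g <- gs) runS x w g).
Definition trT (K : comNzRingType) (x w : K) gs := \tr (\prod_(g <- gs) runT x w g).

Lemma rmorph_trS (K K' : comNzRingType) (f : {rmorphism K -> K'}) x w gs :
  f (trS x w gs) = trS (f x) (f w) gs.
Proof.
rewrite /trS !tr2E rmorphD.
have := map_mx2_prod f (runS x w) gs.
move/matrixP=> H; have H0 := H 0 0; have H1 := H 1 1; rewrite !mxE in H0 H1.
by rewrite H0 H1; under eq_bigr do rewrite map_runS.
Qed.

Lemma rmorph_trT (K K' : comNzRingType) (f : {rmorphism K -> K'}) x w gs :
  f (trT x w gs) = trT (f x) (f w) gs.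
Proof.
rewrite /trT !tr2E rmorphD.
have := map_mx2_prod f (runT x w) gs.
move/matrixP=> H; have H0 := H 0 0; have H1 := H 1 1; rewrite !mxE in H0 H1.
by rewrite H0 H1; under eq_bigr do rewrite map_runT.
Qed.

Lemma trTS (K : comNzRingType) (x w : K) gs :
  trT x ((1 - x) * w) gs = (1 - x) ^+ size gs * trS x w gs.
Proof.
rewrite /trT /trS -mxtraceZ; congr (\tr _).
elim: gs => [|g gs IH]; first by rewrite !big_nil scale1r.
by rewrite !big_cons IH runTS /= exprS -scalerAl -scalerAr scalerA.
Qed.

(** The outer variable is [w] and the inner one is [x]: a coefficient of an element of [P2] belongs
    to a power of [w] and is a polynomial in [x]. *)
Notation P2 := {poly {poly rat}}.
Notation px := ('X%:P : P2).
Notation pw := ('X : P2).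
Notation W := (1 - 'X : {poly rat}).

Definition cS gs j : {poly rat} := (trS px pw gs)`_j.
Definition cT gs j : {poly rat} := (trT px pw gs)`_j.

Lemma coef_comp_scaleX (K : comNzRingType) (c : K) (p : {poly K}) n :
  (p \Po (c%:P * 'X))`_n = p`_n * c ^+ n.
Proof.
rewrite coef_comp_poly.
under eq_bigr => i _ do
  rewrite exprMn -polyC_exp coefCM coefXn.
case: (ltnP n (size p)) => hn; last first.
  rewrite (nth_default _ hn) mul0r big1 // => i _.
  by rewrite gtn_eqF ?(leq_trans (ltn_ord i)) // !mulr0.
rewrite (bigD1 (Ordinal hn)) //= eqxx mulr1 big1 ?addr0 // => i.
by rewrite -val_eqE /= eq_sym => /negPf->; rewrite !mulr0.
Qed.

Lemma cTS gs j : cT gs j * W ^+ j = W ^+ size gs * cS gs j.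
Proof.
rewrite /cT -coef_comp_scaleX.
rewrite -[LHS]/((comp_poly _ _)`_j) rmorph_trT /= comp_polyC comp_polyX.
have -> : px = 'X%:P by [].
have -> : W%:P = 1 - px :> P2 by rewrite polyCB.
by rewrite trTS -polyC1 -polyCB -polyC_exp coefCM.
Qed.

(** * The differential identity *)

Notation natpoly := (polyOver (@Num.nat_num_subdef rat)).

Lemma natpolyX n : 'X^n \is a natpoly.
Proof. by rewrite rpredX // polyOverX. Qed.

Lemma natpoly_geo n : geo ('X : {poly rat}) n \is a natpoly.
Proof. by apply: rpred_sum => i _; apply: natpolyX. Qed.

(* [p] at [(1 - x) w] is [(1 - x) ^ n] times a polynomial in [x] and [w] with
   coefficients in [nat]. *)
Definition graded n (p : P2) :=
  forall j, exists2 f, f \is a natpoly & p`_j * W ^+ j = W ^+ n * f.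

Lemma gradedM m n p q : graded m p -> graded n q -> graded (m + n) (p * q).
Proof.
move=> hp hq k.
have hi (i : 'I_k.+1) : exists f, f \is a natpoly /\
    p`_i * q`_(k - i) * W ^+ k = W ^+ (m + n) * f.
  have [f hf ef] := hp i; have [f' hf' ef'] := hq (k - i)%N.
  exists (f * f'); split; first exact: rpredM.
  have ->: W ^+ k = W ^+ i * W ^+ (k - i) by rewrite -exprD subnKC // -ltnS.
  by rewrite exprD [RHS]mulrACA -ef -ef'; ring.
have {hi} [F hF] := fin_all_exists hi.
exists (\sum_(i < k.+1) F i).
  by apply: rpred_sum => i _; have [] := hF i.
rewrite coefM mulr_suml mulr_sumr.
by apply: eq_bigr => i _; have [_ ->] := hF i.
Qed.

Lemma gradedD n p q : graded n p -> graded n q -> graded n (p + q).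
Proof.
move=> hp hq k; have [f hf ef] := hp k; have [f' hf' ef'] := hq k.
by exists (f + f'); rewrite ?rpredD // coefD mulrDl ef ef' mulrDr.
Qed.

Lemma gradedC p : p \is a natpoly -> graded 0 (p%:P).
Proof.
move=> hp j; rewrite coefC; case: eqP => [->|_].
  by exists p; rewrite // !mul1r mulr1.
by exists 0; rewrite ?rpred0 // mul0r mulr0.
Qed.

Lemma gradedCw (p : {poly rat}) : p \is a natpoly -> graded 1 (p%:P * pw).
Proof.
move=> hp j; rewrite coefCM coefX; case: eqP => [->|_].
  by exists p; rewrite // mulr1 mulrC.
by exists 0; rewrite ?rpred0 // mulr0 mul0r mulr0.
Qed.

Lemma graded_subX n : graded 1 (1 - px ^+ n).
Proof.
move=> j; rewrite -polyC_exp -polyC1 -polyCB coefC.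
case: eqP => [->|_].
  exists (geo 'X n); first exact: natpoly_geo.
  by rewrite expr0 mulr1 expr1 geoE.
by exists 0; rewrite ?rpred0 // mul0r mulr0.
Qed.

Lemma graded_runT g i j : graded 1 (runT px pw g i j).
Proof.
have h n : graded 1 (px ^+ n * pw).
  by rewrite -polyC_exp; apply/gradedCw/natpolyX.
rewrite mxE; case: ifP => _; case: ifP => _; by [apply: graded_subX | apply: h].
Qed.

Lemma graded_prodT gs i j :
  graded (size gs) ((\prod_(g <- gs) runT px pw g : 'M_2) i j).
Proof.
elim: gs i j => [|g gs IH] i j.
  rewrite big_nil -[1]/(1%:M) mxE; case: eqP => _.
    by rewrite mulr1n -polyC1; apply/gradedC/rpred1.
  by rewrite mulr0n -polyC0; apply/gradedC/rpred0.
rewrite big_cons mulr2E -[size _]/(1 + size gs)%N.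
by apply: gradedD; apply: gradedM => //; apply: graded_runT.
Qed.

(** Truncation below [w ^ k] followed by evaluation at [w = 1]. *)
Definition lowsum k (p : P2) : {poly rat} := \sum_(i < k) p`_i.

Lemma lowsumD k p q : lowsum k (p + q) = lowsum k p + lowsum k q.
Proof. by rewrite /lowsum -big_split; apply: eq_bigr => i _; rewrite coefD. Qed.

Lemma lowsumN k p : lowsum k (- p) = - lowsum k p.
Proof. by rewrite /lowsum -sumrN; apply: eq_bigr => i _; rewrite coefN. Qed.

Lemma lowsumCM k (c : {poly rat}) p : lowsum k (c%:P * p) = c * lowsum k p.
Proof. by rewrite /lowsum mulr_sumr; apply: eq_bigr => i _; rewrite coefCM. Qed.

Lemma lowsum_sum k I (s : seq I) (F : I -> P2) :
  lowsum k (\sum_(i <- s) F i) = \sum_(i <- s) lowsum k (F i).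
Proof.
elim: s => [|i s IH]; last by rewrite !big_cons lowsumD IH.
by rewrite !big_nil /lowsum big1 // => i _; rewrite coef0.
Qed.

Lemma lowsum_subw k p : lowsum k.+1 ((1 - pw) * p) = p`_k.
Proof.
elim: k => [|k IH]; rewrite /lowsum big_ord_recr /= -/(lowsum _ _).
  by rewrite /lowsum big_ord0 add0r mulrBl mul1r coefB coefXM subr0.
by rewrite IH mulrBl mul1r coefB coefXM /= addrC subrK.
Qed.

(* The row vector (1, - w) times the product of the transfer matrices. *)
Definition defect gs j : P2 :=
  (\prod_(g <- gs) runT px pw g : 'M_2) 0 j -
  pw * (\prod_(g <- gs) runT px pw g : 'M_2) 1 j.

(** The row (1, - w) is almost a left eigenvector of [runT]: it is reproduced with the factor
    [(1 - x) x ^ g], up to [1 - w] times the second row, which [lowsum] collapses to a single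
    coefficient. *)
Lemma defect_cons g gs j :
  defect (g :: gs) j =
  (1 - pw) * (\prod_(g <- g :: gs) runT px pw g : 'M_2) 1 j +
  ((1 - px) * px ^+ g) * defect gs j.
Proof. by rewrite /defect !big_cons !mulr2E !mx2E exprS; ring. Qed.

(* [lowsum k] of the entries of the row vector (1, - w) itself. *)
Definition defect0 k (j : 'I_2) : {poly rat} :=
  if j == 0 then 1 else - (1 < k)%N%:R.

(** Each use of [defect_cons] adds one coefficient that is natural by [graded_prodT]; the initial
    row collects all the factors [(1 - x) x ^ g] and so is pushed up to degree [sumn gs]. *)
Lemma lowsum_defect k gs j : (0 < k)%N -> exists2 f, f \is a natpoly &
  W ^+ k.-1 * lowsum k (defect gs j) =
  W ^+ size gs * f + W ^+ (k.-1 + size gs) * 'X^(sumn gs) * defect0 k j.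
Proof.
case: k => // k _; elim: gs => [|g gs [f hf ef]].
  exists 0; first exact: rpred0.
  rewrite mulr0 add0r addn0 expr0 mulr1; congr (_ * _).
  rewrite /defect big_nil mx2_1 /defect0; case: j => [[|[|j]] //= hj].
    rewrite !mxE /= mulr0 subr0 /lowsum big_ord_recl /= coefC eqxx big1 ?addr0 //.
    by move=> i _; rewrite coefC.
  rewrite !mxE /= mulr1 sub0r lowsumN; congr (- _).
  rewrite /lowsum; case: k => [|k]; first by rewrite big_ord_recl big_ord0 coefX addr0.
  rewrite !big_ord_recl /= !coefX /= add0r big1 ?addr0 // => i _.
  by rewrite coefX.
have [f1 hf1 ef1] := graded_prodT (g :: gs) 1 j k.
exists (f1 + 'X^g * f); first by rewrite rpredD // rpredM // natpolyX.
rewrite defect_cons lowsumD lowsum_subw.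
have ->: (1 - px) * px ^+ g = (W * 'X^g)%:P by rewrite polyCM polyCB polyC_exp.
rewrite lowsumCM mulrDr [W ^+ _ * _`_k]mulrC ef1 /=.
rewrite mulrCA ef /= exprS !exprD exprS; ring.
Qed.

Definition dx (p : P2) : P2 := map_poly (fun q : {poly rat} => q^`()) p.

Lemma coef_dx p i : (dx p)`_i = (p`_i)^`().
Proof. by rewrite coef_map_id0 // deriv0. Qed.

Lemma dxD p q : dx (p + q) = dx p + dx q.
Proof. by apply/polyP => i; rewrite coefD !coef_dx coefD derivD. Qed.

Lemma dxM p q : dx (p * q) = dx p * q + p * dx q.
Proof.
apply/polyP => i; rewrite coefD !coef_dx !coefM raddf_sum -big_split /=.
by apply: eq_bigr => j _; rewrite derivM !coef_dx.
Qed.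

Lemma dxC c : dx c%:P = (c^`())%:P.
Proof.
by apply/polyP => i; rewrite coef_dx !coefC; case: eqP => // _; rewrite deriv0.
Qed.

Lemma dxCw c : dx (c%:P * pw) = (c^`())%:P * pw.
Proof.
by rewrite dxM dxC; have ->: dx pw = 0; rewrite ?mulr0 ?addr0 //;
  apply/polyP => i; rewrite coef_dx coefX coef0; case: eqP => _;
  rewrite ?derivC // -[1]polyC1 derivC.
Qed.

Lemma map_dxM (A B : 'M[P2]_2) :
  map_mx dx (A * B) = map_mx dx A * B + A * map_mx dx B.
Proof.
apply/matrixP => i j; rewrite mxE mulr2E dxD !dxM [RHS]mxE !mulr2E !mxE; ring.
Qed.

Lemma map_dx_prod F gs : map_mx dx (\prod_(g <- gs) F g : 'M[P2]_2) =
  \sum_(i < size gs) \prod_(g <- take i gs) F g * map_mx dx (F (nth 0%N gs i)) *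
     \prod_(g <- drop i.+1 gs) F g.
Proof.
elim: gs => [|g gs IH].
  rewrite big_nil big_ord0; apply/matrixP => i j; rewrite -[1]/(1%:M) !mxE.
  by case: eqP => _; rewrite ?mulr1n ?mulr0n -?polyC1 -?polyC0 dxC derivC.
rewrite big_cons map_dxM IH /= big_ord_recl /= big_nil mul1r drop0.
congr (_ + _); rewrite mulr_sumr; apply: eq_bigr => i _.
by rewrite /= big_cons !mulrA.
Qed.

(** Leibniz rule, with the differentiated factor brought to the front by cyclicity of the trace. *)
Lemma dx_trace F gs : dx (\tr (\prod_(g <- gs) F g : 'M[P2]_2)) =
  \sum_(i < size gs) \tr (map_mx dx (F (nth 0%N gs i)) *
     \prod_(g <- drop i.+1 gs ++ take i gs) F g).
Proof.
transitivity (\tr (map_mx dx (\prod_(g <- gs) F g : 'M[P2]_2))).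
  by rewrite !tr2E dxD !mxE.
rewrite map_dx_prod raddf_sum; apply: eq_bigr => i _.
by rewrite /= -mulrA trM2C big_cat /= mulrA.
Qed.

(** The derivative of [runT] in [x] has rank one: it is this column times the row (-1, w). At
    [g = 0] the truncated exponent [g.-1] is harmless because its coefficient is 0. *)
Definition run_col g : ({poly rat} * {poly rat})%type :=
  ('X^g *+ g.+1, 'X^(g.-1) *+ g).

Lemma dx_runT g : map_mx dx (runT px pw g) =
  mx2 (- (run_col g).1%:P) ((run_col g).1%:P * pw)
      (- (run_col g).2%:P) ((run_col g).2%:P * pw).
Proof.
have h n : dx (1 - px ^+ n) = - ('X^(n.-1) *+ n)%:P.
  by rewrite -polyC_exp -polyC1 -polyCB dxC derivB derivC sub0r derivXn polyCN.
have h' n : dx (px ^+ n * pw) = ('X^(n.-1) *+ n)%:P * pw.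
  by rewrite -polyC_exp dxCw derivXn.
by rewrite /runT map_mx2 !h !h'.
Qed.

Lemma trace_dx_runT g gs :
  \tr (map_mx dx (runT px pw g) * \prod_(g <- gs) runT px pw g) =
  - ((run_col g).1%:P * defect gs 0 + (run_col g).2%:P * defect gs 1).
Proof. by rewrite dx_runT tr2E !mulr2E !mx2E /defect; ring. Qed.

Definition vS gs k : {poly rat} := \sum_(j < k) W ^+ (k.-1 - j) * cS gs j.

Lemma vS_rec gs k : vS gs k.+1 = W * vS gs k + cS gs k.
Proof.
rewrite /vS big_ord_recr /= subnn expr0 mul1r; congr (_ + _).
case: k => [|k]; first by rewrite !big_ord0 mulr0.
rewrite mulr_sumr; apply: eq_bigr => i _ /=.
have hi : (i <= k)%N by rewrite -ltnS.
by rewrite subSn // exprS mulrA.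
Qed.

Lemma lowsum_trT gs k : (0 < k)%N ->
  W ^+ k.-1 * lowsum k (trT px pw gs) = W ^+ size gs * vS gs k.
Proof.
case: k => // k _; rewrite /lowsum /vS !mulr_sumr; apply: eq_bigr => j _ /=.
have hj : (j <= k)%N by rewrite -ltnS.
have -> : W ^+ k = W ^+ (k - j) * W ^+ j by rewrite -exprD subnK.
by rewrite -mulrA [W ^+ j * _]mulrC -/(cT gs j) cTS mulrCA.
Qed.

Lemma lowsum_deriv k p : (lowsum k p)^`() = lowsum k (dx p).
Proof.
by rewrite /lowsum raddf_sum; apply: eq_bigr => i _; rewrite /= coef_dx.
Qed.

Lemma sumn_rot_drop gs (i : 'I_(size gs)) :
  (sumn (drop i.+1 gs ++ take i gs) + nth 0 gs i = sumn gs)%N.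
Proof.
have := cat_take_drop i gs; rewrite (drop_nth 0%N) // => /(congr1 sumn).
by rewrite !sumn_cat /=; lia.
Qed.

Lemma size_rot_drop (gs : seq nat) (i : 'I_(size gs)) :
  size (drop i.+1 gs ++ take i gs) = (size gs).-1.
Proof. rewrite size_cat size_drop size_take ltn_ord; have := ltn_ord i; lia. Qed.

(** Differentiation costs at most one power of [x], so the remainder of [lowsum_defect], paired with
    the column, stays divisible by [x ^ (R - 1)]. *)
Lemma run_col_div g n (e : bool) : (0 < n + g)%N -> exists Y,
  'X^n * ((run_col g).1 - (run_col g).2 * e%:R) = 'X^((n + g).-1) * Y.
Proof.
rewrite /run_col /=; case: g => [|g] hn.
  exists 'X; rewrite mulr0n mul0r subr0 mulr1n expr0 mulr1 -exprSr; congr (_ ^+ _).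
  lia.
exists ('X *+ g.+2 - g.+1%:R * e%:R).
by rewrite addnS /= exprD exprS -[_ *+ g.+2]mulr_natr -[_ *+ g.+1]mulr_natr
  -['X *+ _]mulr_natr; ring.
Qed.

Lemma lowsum_trT_deriv gs k : (0 < k)%N -> (0 < sumn gs)%N ->
  exists f Y, f \is a natpoly /\
  W ^+ k.-1 * (lowsum k (trT px pw gs))^`() =
  - (W ^+ (size gs).-1 * f +
     W ^+ (k.-1 + (size gs).-1) * ('X^((sumn gs).-1) * Y)).
Proof.
move=> k0 R0; rewrite lowsum_deriv /trT dx_trace lowsum_sum mulr_sumr.
have hi (i : 'I_(size gs)) : exists F : {poly rat} * {poly rat},
    F.1 \is a natpoly /\
    W ^+ k.-1 * lowsum k (\tr (map_mx dx (runT px pw (nth 0%N gs i)) *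
       \prod_(g <- drop i.+1 gs ++ take i gs) runT px pw g)) =
    - (W ^+ (size gs).-1 * F.1 +
     W ^+ (k.-1 + (size gs).-1) * ('X^((sumn gs).-1) * F.2)).
  rewrite trace_dx_runT lowsumN lowsumD !lowsumCM.
  set g := nth _ _ _; set l := _ ++ _.
  have [f0 hf0 ef0] := lowsum_defect l 0 k0.
  have [f1 hf1 ef1] := lowsum_defect l 1 k0.
  have hs : (sumn l + g)%N = sumn gs by exact: sumn_rot_drop.
  have [Y hY] : exists Y, 'X^(sumn l) * ((run_col g).1 - (run_col g).2 * (1 < k)%:R) =
     'X^((sumn gs).-1) * Y by rewrite -hs; apply: run_col_div; rewrite hs.
  exists ((run_col g).1 * f0 + (run_col g).2 * f1, Y); split.
    by rewrite /= rpredD // rpredM // rpredMn // natpolyX.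
  rewrite -hY mulrN; congr (- _).
  set c1 := (run_col g).1; set c2 := (run_col g).2.
  have -> (u p q : {poly rat}) : u * (c1 * p + c2 * q) = c1 * (u * p) + c2 * (u * q).
    by ring.
  rewrite ef0 ef1.
  by rewrite !size_rot_drop /defect0 /=; ring.
have [F hF] := fin_all_exists hi.
exists (\sum_i (F i).1), (\sum_i (F i).2); split.
  by apply: rpred_sum => i _; have [] := hF i.
rewrite !mulr_sumr -big_split /= -sumrN; apply: eq_bigr => i _.
by have [_ ->] := hF i.
Qed.

Lemma deriv_W_exp n : W * (W ^+ n)^`() = - (n%:R * W ^+ n).
Proof.
rewrite deriv_exp derivB derivC derivX sub0r; case: n => [|n].
  by rewrite mulr0n !mul0r mulr0 oppr0.
by rewrite -mulr_natr exprS /=; ring.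
Qed.

Lemma W_neq0 : W != 0.
Proof.
apply/eqP => /(congr1 (fun p : {poly rat} => p`_0)).
by rewrite coefB coefX coef0 -polyC1 coefC subr0 => /eqP; rewrite oner_eq0.
Qed.

(** Differentiating [lowsum_trT] and multiplying by [1 - x] turns the two powers of [1 - x] into the
    constants [Z] and [k - 1]. *)
Lemma vS_deriv gs k : (0 < k)%N ->
  W ^+ size gs * (((size gs)%:R - k.-1%:R) * vS gs k - W * (vS gs k)^`()) =
  - (W * (W ^+ k.-1 * (lowsum k (trT px pw gs))^`())).
Proof.
move=> k0; have e := lowsum_trT gs k0.
have h := congr1 (fun p => W * p^`()) e.
rewrite !derivM !mulrDr ![W * (_ * _)]mulrA !deriv_W_exp in h.
rewrite -![W * _ * _^`()]mulrA !mulNr -![_%:R * _ * _]mulrA e in h.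
move: h; set a := W * (W ^+ k.-1 * _); set b := W ^+ _ * vS _ _; set c := W * (W ^+ _ * _).
move=> h; have -> : a = - ((size gs)%:R * b) + c + k.-1%:R * b.
  by rewrite -h; ring.
by rewrite /b /c; ring.
Qed.

Lemma vS_ode gs k : (0 < k)%N -> (0 < sumn gs)%N ->
  exists f Y, f \is a natpoly /\
  ((size gs)%:R - k.-1%:R) * vS gs k - W * (vS gs k)^`() =
  f + 'X^((sumn gs).-1) * Y.
Proof.
move=> k0 R0; have [f [Y [hf ef]]] := lowsum_trT_deriv k0 R0.
exists f, (W ^+ k.-1 * Y); split => //.
have sz : (0 < size gs)%N by case: gs R0 {ef}.
apply: (mulfI (expf_neq0 (size gs) W_neq0)).
rewrite [LHS]vS_deriv // ef -[size gs in RHS](prednK sz) exprD exprS; ring.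
Qed.

Lemma natpoly_cS gs j : cS gs j \is a natpoly.
Proof.
have [f hf ef] : exists2 f, f \is a natpoly & cT gs j * W ^+ j = W ^+ size gs * f.
  by rewrite /cT /trT tr2E; apply: gradedD; apply: graded_prodT.
by move: ef; rewrite cTS => /(mulfI (expf_neq0 _ W_neq0)) ->.
Qed.

(** * Integrality and sign of the numbers E_k *)

Notation intpoly := (polyOver (@Num.int_num_subdef rat)).

Lemma intpoly_vS gs k : vS gs k \is a intpoly.
Proof.
have hW : W \is a intpoly by rewrite rpredB ?rpred1 // polyOverX.
elim: k => [|k IH]; first by rewrite /vS big_ord0 rpred0.
rewrite vS_rec rpredD ?rpredM //.
apply/polyOverP => i; have /polyOverP/(_ i) := natpoly_cS gs k.
exact: (@intr_nat rat).
Qed.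

Definition defic gs k : rat :=
  2 * (vS gs k)`_(size gs - k).-1 - (vS gs k)`_(size gs - k).

Lemma int_defic gs k : defic gs k \is a Num.int.
Proof.
have /polyOverP h := intpoly_vS gs k.
by apply: rpredB; [apply: rpredM; [apply: rpred_nat | apply: h] | apply: h].
Qed.

Lemma coefW (p : {poly rat}) i : (W * p)`_i.+1 = p`_i.+1 - p`_i.
Proof. by rewrite mulrBl mul1r coefB coefXM. Qed.

Lemma coefW0 (p : {poly rat}) : (W * p)`_0 = p`_0.
Proof. by rewrite mulrBl mul1r coefB coefXM subr0. Qed.

(** With [n = Z - k - 1], the coefficient of degree [n] on the right is [(n + 2) v_n - ((n + 1)
    v_(n+1) - n v_n) = (n + 1) (2 v_n - v_(n+1))]. *)
Lemma defic_ode gs k : (0 < k < size gs)%N ->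
  (size gs - k)%:R * defic gs k =
  (((size gs)%:R - k.-1%:R) * vS gs k - W * (vS gs k)^`())`_(size gs - k).-1.
Proof.
move=> /andP[k0 kZ]; have -> : (size gs)%:R - k.-1%:R = ((size gs - k.-1)%:R)%:P :> {poly
  rat}.
  rewrite -natrB ?polyC_natr //; lia.
rewrite coefB coefCM /defic.
have [n en] : exists n, (size gs - k)%N = n.+1 by exists (size gs - k).-1; lia.
have -> : (size gs - k.-1)%N = n.+2 by lia.
rewrite en /=; case: n en => [|n] en.
  by rewrite coefW0 coef_deriv; ring.
by rewrite coefW !coef_deriv; ring.
Qed.

Lemma defic_ge0 gs k : (0 < k < size gs)%N -> (size gs <= sumn gs)%N ->
  0 <= defic gs k.
Proof.
move=> hk hR; have /andP[k0 kZ] := hk.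
have R0 : (0 < sumn gs)%N by lia.
have [f [Y [hf ef]]] := vS_ode k0 R0.
have := defic_ode hk; rewrite ef coefD coefXnM.
(* Since [Z <= R], the coefficient read off lies below the degree [R - 1] where the uncontrolled
   remainder begins. *)
have -> : ((size gs - k).-1 < (sumn gs).-1)%N by lia.
rewrite addr0 => e.
have : 0 <= (size gs - k)%:R * defic gs k.
  by rewrite e natr_ge0 //; have /polyOverP := hf; apply.
by rewrite pmulr_rge0 // ltr0n subn_gt0.
Qed.

(** * Telescoping at x = 1/2 *)

Notation hf := (2^-1 : rat).

Lemma half_sumW (p : {poly rat}) n :
  \sum_(u < n.+1) (W * p)`_u * hf ^+ u =
  \sum_(u < n.+1) p`_u * hf ^+ u - hf * \sum_(u < n) p`_u * hf ^+ u.
Proof.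
rewrite [LHS]big_ord_recl [in RHS]big_ord_recl coefW0 -addrA; congr (_ + _).
rewrite mulr_sumr -sumrB; apply: eq_bigr => i _.
by rewrite coefW exprS; ring.
Qed.

(** The recursion [vS_rec] carries the truncated value of [v_J] at [x = 1/2] from [J] to [J + 1].
    Multiplication by [1 - x] halves this value up to the two top coefficients, and these combine to
    [defic gs J]. *)
Lemma defic_telescope gs J : (J <= size gs)%N ->
  \sum_(j < J) \sum_(u < size gs - j) (cS gs j)`_u * hf ^+ u * hf ^+ (size gs - j) =
  hf ^+ (size gs - J).+1 * \sum_(u < (size gs - J).+1) (vS gs J)`_u * hf ^+ u -
  hf * \sum_(k < J) hf ^+ (size gs - k).*2 * defic gs k.
Proof.
elim: J => [|J IH] hJ.
  by rewrite !big_ord0 mulr0 subr0 big1 ?mulr0 // => i _;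
     rewrite /vS big_ord0 coef0 mul0r.
rewrite [LHS]big_ord_recr [X in _ - _ * X]big_ord_recr /= IH; last exact: ltnW.
rewrite -mulr_suml [defic gs J]/defic.
have [n en] : exists n, (size gs - J)%N = n.+1 by exists (size gs - J).-1; lia.
have -> : (size gs - J.+1)%N = n by lia.
rewrite en vS_rec /=.
have -> : \sum_(u < n.+1) (W * vS gs J + cS gs J)`_u * hf ^+ u =
   \sum_(u < n.+1) (W * vS gs J)`_u * hf ^+ u + \sum_(u < n.+1) (cS gs J)`_u * hf ^+ u.
  by rewrite -big_split; apply: eq_bigr => i _; rewrite coefD mulrDl.
rewrite half_sumW [\sum_(u < n.+2) _]big_ord_recr /= [\sum_(u < n.+1) (vS gs J)`_u *
  _]big_ord_recr /=.
set s := \sum_(u < n) _; set c := \sum_(u < n.+1) _; set e := \sum_(k < J) _.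
have -> : hf ^+ (n.+1).*2 = hf ^+ n * hf ^+ n * hf * hf.
  by rewrite -addnn exprD exprS; ring.
by rewrite !exprS; field.
Qed.

(** At [x = 0] every block is lower triangular with upper left entry 1, and any nonzero gap kills
    the lower right entry. *)
Lemma trS0 w gs : (0 < sumn gs)%N -> trS (0 : {poly rat}) w gs = 1.
Proof.
move=> R0; suff [c e] : exists c, \prod_(g <- gs) runS (0 : {poly rat}) w g =
    mx2 1 0 c (if sumn gs == 0%N then w ^+ size gs else 0).
  by rewrite /trS e tr2E !mx2E gtn_eqF // addr0.
elim: gs {R0} => [|g gs [c IH]]; first by exists 0; rewrite big_nil mx2_1.
have geo00 n : geo (0 : {poly rat}) n.+1 = 1.
  by rewrite /geo big_ord_recl big1 ?addr0 // => i _; rewrite /= exprS mul0r.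
exists (geo 0 g + 0 ^+ g * w * c).
rewrite big_cons IH /runS mx2M geo00 exprS !mul0r !mulr0 !addr0 !mulr1 ?add0r /=.
congr mx2; case: g => [|g]; rewrite ?expr0 ?mul1r //=.
  by case: ifP => _; rewrite ?add0n ?mulr0 // exprS.
by rewrite exprS !mul0r.
Qed.

Lemma cS_coef0 gs j : (0 < sumn gs)%N -> (cS gs j)`_0 = (j == 0)%N%:R.
Proof.
move=> R0; pose f := map_poly (horner_eval (0 : rat)).
have := rmorph_trS f px pw gs.
rewrite /f /= map_polyX map_polyC /= horner_evalE hornerX polyC0 trS0 //.
move=> /(congr1 (fun p : {poly rat} => p`_j)).
rewrite coef_map /= horner_evalE -polyC1 coefC horner_coef0 -/(cS gs j) => ->.
by case: eqP.
Qed.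

Lemma vS_coef0 gs k : (0 < k)%N -> (0 < sumn gs)%N -> (vS gs k)`_0 = 1.
Proof.
move=> + R0; elim: k => // -[|k] IH _.
  by rewrite vS_rec /vS big_ord0 mulr0 add0r cS_coef0.
by rewrite vS_rec coefD coefW0 IH // cS_coef0 // addr0.
Qed.

Lemma triangle_sum (F : nat -> nat -> rat) n :
  \sum_(d < n) \sum_(j < d.+1) F j (d - j)%N = \sum_(j < n) \sum_(u < n - j) F j u.
Proof.
elim: n => [|n IH]; first by rewrite !big_ord0.
rewrite big_ord_recr /= IH !big_ord_recr /= subSnn big_ord1 subnn addrA; congr (_ + _).
rewrite -big_split; apply: eq_bigr => j _ /=.
by rewrite subSn ?(ltnW (ltn_ord j)) // big_ord_recr.
Qed.

(** The trace at [x = z / 2] and [w = 2 z], the values at which a block of the word becomes a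
    multiple of [runS]. *)
Definition tau gs : {poly rat} := trS (hf%:P * 'X) (2%:P * 'X) gs.

Lemma coef_tau gs d :
  (tau gs)`_d = \sum_(j < d.+1) 2 ^+ j * hf ^+ (d - j) * (cS gs j)`_(d - j).
Proof.
pose f := horner_eval (2%:P * 'X : {poly rat}) \o map_poly (comp_poly (hf%:P * 'X)).
have := rmorph_trS f px pw gs.
rewrite /f /= map_polyC map_polyX /= !horner_evalE hornerC hornerX comp_polyX => e.
rewrite /tau -e (@horner_coef_wide _ (maxn d.+1 (size (trS px pw gs)))); last first.
  by apply: leq_trans (size_poly _ _) _; apply: leq_maxr.
set n := maxn _ _; have hn : (d.+1 <= n)%N by apply: leq_maxl.
rewrite coef_sum (big_ord_widen_cond n xpredT
  (fun j => 2 ^+ j * hf ^+ (d - j) * (cS gs j)`_(d - j))) //.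
rewrite [RHS]big_mkcond /=; apply: eq_bigr => j _.
rewrite coef_map /= exprMn -polyC_exp mulrCA coefCM coefMXn ltnNge ltnS.
case: leqP => hj; last by rewrite mulr0.
by rewrite coef_comp_scaleX mulrA mulrAC.
Qed.

(** The monomial [x ^ u w ^ j] acquires degree [j + u] in [z], so degrees below [Z] form the
    triangle summed in [defic_telescope]. At [J = Z] only the constant coefficient 1 of [v_Z] is
    left, and it gives the main term. *)
Lemma sum_tau gs : (0 < size gs)%N -> (0 < sumn gs)%N ->
  \sum_(d < size gs) (tau gs)`_d = hf * 2 ^+ size gs -
  hf * \sum_(k < size gs) 2 ^+ size gs * hf ^+ (size gs - k).*2 * defic gs k.
Proof.
move=> Z0 R0; under eq_bigr do rewrite coef_tau.
rewrite (triangle_sum (fun j u => 2 ^+ j * hf ^+ u * (cS gs j)`_u)).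
transitivity (2 ^+ size gs * \sum_(j < size gs)
   \sum_(u < size gs - j) (cS gs j)`_u * hf ^+ u * hf ^+ (size gs - j)).
  rewrite mulr_sumr; apply: eq_bigr => j _; rewrite mulr_sumr; apply: eq_bigr => u _.
  have -> : 2 ^+ size gs = 2 ^+ j * 2 ^+ (size gs - j) :> rat.
    by rewrite -exprD subnKC // ltnW.
  have e : 2 ^+ (size gs - j) * hf ^+ (size gs - j) = 1.
    by rewrite -exprMn divff // expr1n.
  transitivity (2 ^+ j * hf ^+ u * (cS gs j)`_u * (2 ^+ (size gs - j) * hf ^+ (size gs -
    j))).
    by rewrite e mulr1.
  by ring.
rewrite defic_telescope // subnn big_ord1 vS_coef0 // expr1 expr0 !mulr1 mulrBr.
congr (_ - _); first by rewrite mulrC.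
rewrite mulrCA; congr (_ * _); rewrite mulr_sumr.
by apply: eq_bigr => k _; rewrite mulrA.
Qed.

(** * Carries *)

(* [bitmx b] is the weighted transfer matrix, from the carry in to the carry
   out, of the bits of the summands at a position where the sum has bit [b]. *)
Definition bitmx (b : bool) : 'M[{poly rat}]_2 :=
  if b then mx2 (2%:P * 'X) 0 1 ('X ^+ 2) else mx2 1 ('X ^+ 2) 0 (2%:P * 'X).

(** Here [c0] is the carry into the lowest of the [k] positions and [c1] the carry out of the
    highest. *)
Definition sum_term k (c0 c1 : 'I_2) t a b : {poly rat} :=
  if (a + b + c0 == t + c1 * 2 ^ k)%N then 'X^(wt a + wt b) else 0.

Lemma sum_double (V : nmodType) (F : nat -> V) n :
  \sum_(a < 2 * n) F a = \sum_(a < n) (F (false + a.*2)%N + F (true + a.*2)%N).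
Proof.
elim: n => [|n IH]; first by rewrite muln0 !big_ord0.
rewrite mulnS add2n !big_ord_recr IH /= -addrA mul2n; congr (_ + (_ + _)).
Qed.

(** The four choices of lowest bits of the summands are sorted by the carry they produce, which
    becomes the carry into the addition of the halves. *)
Lemma sum_term_step k (c0 c1 : 'I_2) t a b :
  sum_term k.+1 c0 c1 t (false + a.*2) (false + b.*2) +
  sum_term k.+1 c0 c1 t (false + a.*2) (true + b.*2) +
  (sum_term k.+1 c0 c1 t (true + a.*2) (false + b.*2) +
   sum_term k.+1 c0 c1 t (true + a.*2) (true + b.*2)) =
  bitmx (odd t) c0 0 * sum_term k 0 c1 t./2 a b +
  bitmx (odd t) c0 1 * sum_term k 1 c1 t./2 a b.
Proof.
rewrite /sum_term !wt_cons expnS -[in LHS](odd_double_half t).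
set u := (t./2); set p := (2 ^ k)%N; set w := (wt a); set w' := wt b.
have e0 : c0 = 0 \/ c0 = 1.
  by case: c0 => [[|[|c]] hc] //; [left|right]; apply/val_inj.
have E (x y : nat) : (x == y) = (x == y :> nat) by [].
have X1 : 'X^(w + (1 + w')) = 'X * 'X^(w + w') :> {poly rat}.
  by rewrite -exprS; congr (_ ^+ _); lia.
have X1' : 'X^(1 + w + w') = 'X * 'X^(w + w') :> {poly rat}.
  by rewrite -exprS; congr (_ ^+ _); lia.
have X2 : 'X^(1 + w + (1 + w')) = 'X ^+ 2 * 'X^(w + w') :> {poly rat}.
  by rewrite -exprD; congr (_ ^+ _); lia.
case: e0 => ->; case: (odd t); rewrite /bitmx !mx2E /= ?add0n ?addn0.
- have -> : (a.*2 + b.*2 == 1 + u.*2 + c1 * (2 * p))%N = false by lia.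
  have -> : (a.*2 + (1 + b.*2) == 1 + u.*2 + c1 * (2 * p))%N = (a + b == u + c1 * p)%N by
    lia.
  have -> : (1 + a.*2 + b.*2 == 1 + u.*2 + c1 * (2 * p))%N = (a + b == u + c1 * p)%N by lia.
  have -> : (1 + a.*2 + (1 + b.*2) == 1 + u.*2 + c1 * (2 * p))%N = false by lia.
  by rewrite X1 X1'; case: ifP => _; ring.
- have -> : (a.*2 + b.*2 == u.*2 + c1 * (2 * p))%N = (a + b == u + c1 * p)%N by lia.
  have -> : (a.*2 + (1 + b.*2) == u.*2 + c1 * (2 * p))%N = false by lia.
  have -> : (1 + a.*2 + b.*2 == u.*2 + c1 * (2 * p))%N = false by lia.
  have -> : (1 + a.*2 + (1 + b.*2) == u.*2 + c1 * (2 * p))%N = (a + b + 1 == u + c1 *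
    p)%N by lia.
  by rewrite X2; do 2![case: ifP => _]; ring.
- have -> : (a.*2 + b.*2 + 1 == 1 + u.*2 + c1 * (2 * p))%N = (a + b == u + c1 * p)%N by lia.
  have -> : (a.*2 + (1 + b.*2) + 1 == 1 + u.*2 + c1 * (2 * p))%N = false by lia.
  have -> : (1 + a.*2 + b.*2 + 1 == 1 + u.*2 + c1 * (2 * p))%N = false by lia.
  have -> : (1 + a.*2 + (1 + b.*2) + 1 == 1 + u.*2 + c1 * (2 * p))%N = (a + b + 1 == u +
    c1 * p)%N by lia.
  by rewrite X2; do 2![case: ifP => _]; ring.
- have -> : (a.*2 + b.*2 + 1 == u.*2 + c1 * (2 * p))%N = false by lia.
  have -> : (a.*2 + (1 + b.*2) + 1 == u.*2 + c1 * (2 * p))%N = (a + b + 1 == u + c1 *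
    p)%N by lia.
  have -> : (1 + a.*2 + b.*2 + 1 == u.*2 + c1 * (2 * p))%N = (a + b + 1 == u + c1 * p)%N
    by lia.
  have -> : (1 + a.*2 + (1 + b.*2) + 1 == u.*2 + c1 * (2 * p))%N = false by lia.
  by rewrite X1 X1'; do 1?[case: ifP => _]; ring.
Qed.

Lemma prod_bitmx k t c0 c1 : (t < 2 ^ k)%N ->
  (\prod_(b <- word k t) bitmx b) c0 c1 =
  \sum_(a < 2 ^ k) \sum_(b < 2 ^ k) sum_term k c0 c1 t a b.
Proof.
elim: k t c0 c1 => [|k IH] t c0 c1 ht.
  have -> : t = 0%N by move: ht; rewrite expn0; lia.
  rewrite expn0 !big_ord1 big_nil -[1]/(1%:M) mxE /sum_term /wt big_ord0 expr0 muln1 /=.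
  by rewrite -val_eqE; case: eqP.
rewrite word_cons big_cons mulr2E.
have ht2 : (t./2 < 2 ^ k)%N by move: ht; rewrite expnS; lia.
rewrite !IH // !mulr_sumr -big_split [in LHS]/=.
rewrite expnS (sum_double (fun a => \sum_(b < 2 * 2 ^ k) sum_term k.+1 c0 c1 t a b)).
apply: eq_bigr => a _; rewrite !mulr_sumr -big_split.
rewrite !(sum_double (fun b => sum_term k.+1 c0 c1 t _ b)) -big_split.
by apply: eq_bigr => b _; rewrite /= sum_term_step.
Qed.

Lemma sum_coef_Xn k n : \sum_(d < k) ('X^n : {poly rat})`_d = (n < k)%N%:R.
Proof.
case: (ltnP n k) => h.
  rewrite (bigD1 (Ordinal h)) //= coefXn eqxx big1 ?addr0 // => i.
  by rewrite -val_eqE /= coefXn => /negPf->.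
rewrite big1 // => i _; rewrite coefXn ltn_eqF //.
by rewrite (leq_trans (ltn_ord i)).
Qed.

(** Two residues add up to less than [2 N], so a sum congruent to [t] is [t] or [t + N], and these
    are distinct. *)
Lemma eqmod_carry N t a b : (0 < t < N)%N -> (a < N)%N -> (b < N)%N ->
  ((a + b == t %[mod N]) : nat) = ((a + b == t) + (a + b == t + N))%N.
Proof.
move=> /andP[t0 tN] aN bN; rewrite (modn_small tN).
case: (ltnP (a + b) N) => h.
  have -> : (a + b == t + N)%N = false by apply/eqP; lia.
  by rewrite modn_small // addn0.
have -> : ((a + b) %% N = a + b - N)%N.
  by rewrite -{1}(subnK h) modnDr modn_small //; lia.
have -> : (a + b == t)%N = false by apply/eqP; lia.
by congr nat_of_bool; apply/eqP/eqP; lia.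
Qed.

(** The trace equates the carries in and out: carry 0 means [a + b = t], and carry 1 means
    [a + b + 1 = t + 2 ^ k], that is [a + b = t + N]. *)
Lemma card_S_trace k t : (1 < k)%N -> (0 < t < 2 ^ k - 1)%N ->
  (#|S_set t k|%:R : rat) =
  \sum_(d < k) (\tr (\prod_(b <- word k t) bitmx b))`_d.
Proof.
move=> hk /andP[t0 tN].
set N := (2 ^ k - 1)%N in tN *.
have eN : (2 ^ k)%N = N.+1 by rewrite /N subn1 prednK // expn_gt0.
have ht : (t < 2 ^ k)%N by rewrite eN ltnS ltnW.
pose w a b : nat := (wt a + wt b)%N.
have term (c : 'I_2) a b : \sum_(d < k) (sum_term k c c t a b)`_d =
    ((a + b + c == t + c * 2 ^ k) && (w a b < k))%N%:R.
  rewrite /sum_term; case: ifP => _; first by rewrite sum_coef_Xn.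
  by rewrite big1 // => i _; rewrite coef0.
transitivity (\sum_(a < 2 ^ k) \sum_(b < 2 ^ k)
   (((a + b == t) + (a + b == t + N)) * (w a b < k))%N%:R : rat); last first.
  rewrite tr2E; under [RHS]eq_bigr do rewrite coefD.
  rewrite big_split /= !prod_bitmx //.
  have ex (c : 'I_2) : \sum_(d < k)
     (\sum_(a < 2 ^ k) \sum_(b < 2 ^ k) sum_term k c c t a b)`_d =
     \sum_(a < 2 ^ k) \sum_(b < 2 ^ k)
       ((a + b + c == t + c * 2 ^ k) && (w a b < k))%N%:R.
    under eq_bigr do rewrite coef_sum.
    rewrite exchange_big; apply: eq_bigr => a _ /=.
    under eq_bigr do rewrite coef_sum.
    rewrite exchange_big; apply: eq_bigr => b _ /=.
    exact: term.
  rewrite !ex -big_split; apply: eq_bigr => a _ /=; rewrite -big_split.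
  apply: eq_bigr => b _ /=; rewrite -natrD; congr (_%:R).
  have -> : (a + b + 0 == t + 0 * 2 ^ k)%N = (a + b == t)%N by lia.
  have -> : (a + b + 1 == t + 1 * 2 ^ k)%N = (a + b == t + N)%N.
    by apply/eqP/eqP; rewrite mul1n; lia.
  by rewrite mulnDl !mulnb.
(* The matrix product also ranges over the summand [N], which is not a residue; its weight is [k],
   so the weight bound discards it. *)
rewrite eN big_ord_recr /= [X in _ + X]big1 ?addr0; last first.
  move=> b _; have -> : (w N b < k)%N = false by rewrite /w wt_ones; lia.
  by rewrite muln0.
transitivity (\sum_(a < N) \sum_(b < N)
   (((a + b == t) + (a + b == t + N)) * (w a b < k))%N%:R : rat); last first.
  apply: eq_bigr => a _; rewrite big_ord_recr /= [X in _ + X](_ : _ = 0) ?addr0 //.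
  have -> : (w a N < k)%N = false by rewrite /w wt_ones; lia.
  by rewrite muln0.
rewrite pair_big /= -sum1_card natr_sum big_mkcond /=.
apply: eq_bigr => -[a b] _; rewrite inE /=.
rewrite -(eqmod_carry _ (ltn_ord a) (ltn_ord b)) ?t0 // -/N.
by case: eqP => _ /=; rewrite ?mul1n ?mul0n //; rewrite /w; case: ltnP.
Qed.

Lemma prod_nseq_true g : \prod_(b <- nseq g true) bitmx b = bitmx true ^+ g.
Proof. by elim: g => [|g IH]; rewrite ?big_nil // big_cons IH exprS. Qed.

Lemma bitmx_run g : bitmx false * bitmx true ^+ g =
  (2%:P * 'X) ^+ g *: runS (hf%:P * 'X : {poly rat}) (2%:P * 'X) g.
Proof.
set y := hf%:P * 'X; set w := 2%:P * 'X.
have ew : 'X ^+ 2 = w * y.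
  by rewrite /w /y mulrACA -polyCM divff // mul1r.
have et : bitmx true = mx2 w 0 1 (w * y) by rewrite /bitmx ew.
elim: g => [|g IH].
  by rewrite expr0 mulr1 scale1r /runS /bitmx ew geoS geo0 !expr0 expr1 add0r mul1r mulrC.
rewrite exprSr mulrA IH et /runS !scale_mx2 mx2M.
by rewrite [geo y g.+2]geoS [geo y g.+1]geoS !exprS; congr mx2; ring.
Qed.

Lemma trace_rot (F : bool -> 'M[{poly rat}]_2) r s :
  \tr (\prod_(b <- rot r s) F b) = \tr (\prod_(b <- s) F b).
Proof. by rewrite -[in RHS](cat_take_drop r s) /rot !big_cat /= trM2C. Qed.

(** The trace is invariant under rotation, so the word may start with a zero and be cut into blocks,
    each a zero with the ones that follow. The order of [gs] depends on this rotation, hence the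
    permutation. *)
Lemma trace_word w : has negb w -> exists gs : seq nat,
  [/\ perm_eq gs (cyclic_gaps w), size gs = count negb w, sumn gs = count id w &
      \tr (\prod_(b <- w) bitmx b) = (2%:P * 'X) ^+ sumn gs * tau gs].
Proof.
move=> hw; set r := find negb w; set w' := rot r w.
have hr : (r < size w)%N by rewrite -has_find.
have [s es] : exists s, w' = false :: s.
  have := nth_find true hw; rewrite -/r => /negbTE h.
  by exists (drop r.+1 w ++ take r w); rewrite /w' /rot (drop_nth true) // h.
exists (lin_gaps w'); split.
- by rewrite es -cyclic_gaps_lin -es cyclic_gaps_rot.
- by rewrite size_lin_gaps; apply/permP; rewrite perm_rot.
- have := sumn_lin_gaps w'; rewrite {1}es add0n => ->.
  by apply/permP; rewrite perm_rot.
rewrite -(trace_rot _ r) -/w' [in LHS](lin_gapsK w') {1}es cat0s.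
rewrite /tau /trS -mxtraceZ; congr (\tr _).
elim: (lin_gaps w') => [|g gs IH]; first by rewrite !big_nil expr0 scale1r.
rewrite /= big_cons big_cat /= IH prod_nseq_true mulrA bitmx_run big_cons.
by rewrite exprD -scalerAl -scalerAr scalerA.
Qed.

(** As [k = R + Z], the factor [(2 z) ^ R] turns degrees below [k] into degrees below [Z]. *)
Lemma card_S_tau k t : (1 < k)%N -> (0 < t < 2 ^ k - 1)%N -> (0 < zeros k t)%N ->
  exists gs : seq nat, [/\ perm_eq gs (gaps k t), size gs = zeros k t, sumn gs = ones k t &
    (#|S_set t k|%:R : rat) = 2 ^+ sumn gs * \sum_(d < size gs) (tau gs)`_d].
Proof.
move=> hk ht hZ; have hw : has negb (word k t) by rewrite has_count.
have [gs [h1 h2 h3 h4]] := trace_word hw.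
exists gs; split => //; rewrite (card_S_trace hk ht) h4.
have ek : (k = sumn gs + size gs)%N.
  by rewrite h2 h3 count_predC /word size_mkseq.
rewrite -(big_mkord xpredT (fun d => (_ : {poly rat})`_d)) {1}ek big_mkord big_split_ord
  /= big1 ?add0r => [|d _]; last first.
  by rewrite exprMn -polyC_exp -mulrA coefCM coefXnM ltn_ord mulr0.
rewrite [RHS]mulr_sumr; apply: eq_bigr => d _.
by rewrite exprMn -polyC_exp -mulrA coefCM coefXnM ltnNge leq_addr /= addKn.
Qed.

Definition total_defic gs : rat :=
  \sum_(1 <= k < size gs) 4 ^+ k.-1 * defic gs k.

Lemma card_S_defic k t : (1 < k)%N -> (0 < t < 2 ^ k - 1)%N ->
  (0 < zeros k t <= ones k t)%N ->
  exists gs : seq nat, [/\ perm_eq gs (gaps k t), size gs = zeros k t, sumn gs = ones k t &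
    2 ^+ (k - 1) - #|S_set t k|%:R = 2 ^+ (ones k t - zeros k t + 1) * total_defic gs].
Proof.
move=> hk ht /andP[hZ hZR]; have [gs [h1 h2 h3 h4]] := card_S_tau hk ht hZ.
exists gs; split => //; rewrite h4 sum_tau ?h2 //; last by rewrite h3; lia.
have ek : (k = sumn gs + size gs)%N.
  by rewrite h2 h3 count_predC /word size_mkseq.
have e1 : 2 ^+ (k - 1) = 2 ^+ sumn gs * (hf * 2 ^+ zeros k t) :> rat.
  have -> : (k - 1 = sumn gs + (zeros k t).-1)%N by lia.
  by rewrite exprD -[in RHS](prednK hZ) exprS; field.
rewrite e1 -mulrBr opprB addrC subrK /total_defic !mulr_sumr {e1}.
(* From here on [Z] is the number of zeros minus one, and after the vanishing term at 0 is split off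
   the index [i] stands for [k = i + 1]. *)
case: (zeros k t) h2 hZ hZR => // Z h2 _ hZR; rewrite h2.
have d0 : defic gs 0 = 0 by rewrite /defic /vS !big_ord0 !coef0 mulr0 subrr.
rewrite big_add1 /= big_mkord big_ord_recl d0 !mulr0 add0r; apply: eq_bigr => i _ /=.
rewrite !mulrA; congr (_ * _); rewrite /bump /= add1n subSS.
have hi := ltn_ord i.
have -> : (ones k t - Z.+1 + 1 = sumn gs - Z)%N by rewrite h3; lia.
have -> : 4 ^+ i = 2 ^+ i * 2 ^+ i :> rat by rewrite -exprMn; congr (_ ^+ _); ring.
have e2 : 2 ^+ sumn gs = 2 ^+ (sumn gs - Z) * (2 ^+ i * 2 ^+ (Z - i)) :> rat.
  by rewrite -!exprD; congr (_ ^+ _); rewrite h3; lia.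
have e3 : 2 ^+ Z.+1 = 2 * (2 ^+ i * 2 ^+ (Z - i)) :> rat.
  by rewrite exprS -exprD; congr (_ * _ ^+ _); lia.
have e4 : 2 ^+ (Z - i) * hf ^+ (Z - i) = 1 :> rat by rewrite -exprMn divff // expr1n.
rewrite e2 e3 -addnn exprD.
transitivity (2 ^+ (sumn gs - Z) * (2 ^+ i * 2 ^+ i) * (hf * 2) *
  (2 ^+ (Z - i) * hf ^+ (Z - i)) * (2 ^+ (Z - i) * hf ^+ (Z - i)) : rat).
  by ring.
by have e5 : hf * 2 = 1 by []; rewrite e4 e5 !mulr1 mulrA.
Qed.

(** * The extremal case *)

Definition boxp gs : {poly rat} := \prod_(g <- gs) geo 'X g.+1.

Lemma coef_boxp gs s : (boxp gs)`_s = (box gs s)%:R.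
Proof.
elim: gs s => [|g gs IH] s.
  by rewrite /boxp big_nil coef1 /=; case: eqP.
rewrite /boxp big_cons -/(boxp gs) /geo mulr_suml coef_sum natr_sum.
rewrite [RHS]big_mkcond; apply: eq_bigr => i _.
by rewrite coefXnM ltnNge IH; case: (i <= s)%N.
Qed.

Lemma boxp_perm gs gs' : perm_eq gs gs' -> boxp gs = boxp gs'.
Proof. by move=> h; apply: perm_big. Qed.

Lemma boxp_cons g gs : boxp (g :: gs) = geo 'X g.+1 * boxp gs.
Proof. by rewrite /boxp big_cons. Qed.

Lemma boxp_rem_cons g h gs : h \in gs ->
  boxp (rem h (g :: gs)) = geo 'X g.+1 * boxp (rem h gs).
Proof.
move=> hh; rewrite -boxp_cons /=; case: eqP => // ->.
exact/boxp_perm/perm_to_rem.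
Qed.

Lemma geo_ode g : geo 'X g.+1 - W * (geo 'X g.+1)^`() = 'X^g *+ g.+1 :> {poly rat}.
Proof.
have := congr1 (fun p : {poly rat} => p^`()) (geoE 'X g.+1).
rewrite derivM !derivB !derivC derivX !sub0r derivXn mulN1r /= => h.
by rewrite -[RHS]opprK -h; ring.
Qed.

(** By the Leibniz rule there is one term per gap, in which [geo_ode] replaces the factor of that
    gap by [(g + 1) x ^ g]. *)
Lemma boxp_ode gs : (size gs)%:R * boxp gs - W * (boxp gs)^`() =
  \sum_(g <- gs) ('X^g *+ g.+1) * boxp (rem g gs).
Proof.
elim: gs => [|g gs IH].
  by rewrite /boxp !big_nil mul0r sub0r -polyC1 derivC mulr0 oppr0.
rewrite [in RHS]big_cons /= eqxx -geo_ode.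
transitivity ((geo 'X g.+1 - W * (geo 'X g.+1)^`()) * boxp gs +
   geo 'X g.+1 * ((size gs)%:R * boxp gs - W * (boxp gs)^`())).
  by rewrite boxp_cons derivM -natr1; ring.
rewrite IH; congr (_ + _); rewrite mulr_sumr !big_seq; apply: eq_bigr => h hh.
by rewrite (boxp_rem_cons g hh) mulrCA.
Qed.

(** [v_1] is the trace at [w = 0], where the second column of every block vanishes and the upper
    left entries multiply. *)
Lemma vS1 gs : (0 < size gs)%N -> vS gs 1 = boxp gs.
Proof.
move=> Z0; rewrite /vS big_ord1 /= expr0 mul1r /cS.
have := rmorph_trS (horner_eval (0 : {poly rat})) px pw gs.
rewrite /= !horner_evalE hornerC hornerX horner_coef0 => ->.
suff [c e] : exists c, \prod_(g <- gs) runS ('X : {poly rat}) 0 g =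
    mx2 (boxp gs) 0 c (gs == [::])%:R.
  by rewrite /trS e tr2E !mx2E; case: (gs) Z0 => //= *; rewrite addr0.
elim: gs {Z0} => [|g gs [c IH]].
  by exists 0; rewrite /boxp !big_nil mx2_1.
exists (geo 'X g * boxp gs); rewrite big_cons IH /runS mx2M boxp_cons.
by rewrite !mulr0 !mul0r !addr0.
Qed.

(** The share of one gap in [(Z - 1) E_1]: the coefficient of [x ^ (Z - 2)] in its term of
    [boxp_ode]. *)
Definition gap_weight (gs : seq nat) (g : nat) : nat :=
  if (g <= size gs - 2)%N then (g.+1 * box (rem g gs) (size gs - 2 - g))%N else 0%N.

Lemma defic1 gs : (1 < size gs)%N ->
  (size gs - 1)%:R * defic gs 1 = (\sum_(g <- gs) gap_weight gs g)%:R.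
Proof.
move=> Z1; rewrite defic_ode ?Z1 // subr0 vS1 ?(ltnW Z1) // boxp_ode coef_sum natr_sum.
apply: eq_bigr => g _; rewrite mulrnAl coefMn coefXnM /gap_weight.
have -> : (size gs - 1).-1 = (size gs - 2)%N by lia.
rewrite ltnNge; case: (g <= size gs - 2)%N => /=; last by rewrite mul0rn.
by rewrite coef_boxp natrM mulr_natl.
Qed.

(** * Divisibility by powers of x and vanishing of E_k for k > 1 *)

Definition low n (p : {poly rat}) := forall i, (i < n)%N -> p`_i = 0.

Lemma lowD n p q : low n p -> low n q -> low n (p + q).
Proof. by move=> hp hq i hi; rewrite coefD hp // hq // addr0. Qed.

Lemma lowN n p : low n p -> low n (- p).
Proof. by move=> hp i hi; rewrite coefN hp // oppr0. Qed.

Lemma lowMl n p q : low n q -> low n (p * q).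
Proof.
move=> hq i hi; rewrite coefM big1 // => j _; rewrite hq ?mulr0 //.
exact: leq_ltn_trans (leq_subr _ _) hi.
Qed.

Lemma low_sum n I (s : seq I) (P : pred I) F :
  (forall i, P i -> low n (F i)) -> low n (\sum_(i <- s | P i) F i).
Proof.
move=> h; elim/big_ind: _ => //; first by move=> i _; rewrite coef0.
by move=> *; apply: lowD.
Qed.

Lemma lowXn m n : (m <= n)%N -> low m 'X^n.
Proof. by move=> mn i hi; rewrite coefXn ltn_eqF //; apply: leq_trans mn. Qed.

Lemma low_deriv n p : low n.+1 p -> low n p^`().
Proof. by move=> hp i hi; rewrite coef_deriv hp // mul0rn. Qed.

(** [1 - x] has constant term 1, hence is invertible modulo [x ^ n]. *)
Lemma low_WK n p e : low n (W ^+ e * p) -> low n p.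
Proof.
elim: e => [|e IH] h; first by move: h; rewrite expr0 mul1r.
apply: IH; move: h; rewrite exprS -mulrA; set q := _ * p => h.
elim=> [|i IHi] hi; first by have := h 0%N hi; rewrite coefW0.
by have := h _ hi; rewrite coefW IHi ?subr0 // ltnW.
Qed.

Definition high_low m n (p : P2) := forall j, (n <= j)%N -> low m p`_j.

Lemma high_lowD m n p q : high_low m n p -> high_low m n q -> high_low m n (p + q).
Proof. by move=> hp hq j hj; rewrite coefD; apply: lowD; [apply: hp|apply: hq]. Qed.

Lemma high_lowM m a b p q : high_low m a.+1 p -> high_low m b.+1 q ->
  high_low m (a + b).+1 (p * q).
Proof.
move=> hp hq j hj; rewrite coefM; apply: low_sum => i _.
case: (ltnP a i) => hi; first by rewrite mulrC; apply/lowMl/hp.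
by apply/lowMl/hq; lia.
Qed.

Lemma high_lowC m n c : (0 < n)%N -> high_low m n c%:P.
Proof. by move=> n0 j hj i _; rewrite coefC gtn_eqF ?coef0 //; lia. Qed.

Lemma high_low_Xnw m n k : high_low m ((n < m) + k.+1)%N (px ^+ n * pw).
Proof.
move=> j hj; rewrite -polyC_exp coefCM coefX; case: eqP => [ej|_]; last first.
  by rewrite mulr0 => i _; rewrite coef0.
by rewrite mulr1; apply: lowXn; move: hj; rewrite ej; case: ltnP => //; lia.
Qed.

Lemma high_low_runS m g i j : high_low m (g < m)%N.+1 (runS px pw g i j).
Proof.
have hg n : high_low m (g < m)%N.+1 (geo px n).
  have -> : geo px n = (geo 'X n)%:P by rewrite (rmorph_geo (@polyC {poly rat})).
  exact: high_lowC.
have h n : (g <= n)%N -> high_low m (g < m)%N.+1 (px ^+ n * pw).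
  move=> gn k hk; apply: (high_low_Xnw (k := 0)).
  by apply: leq_trans hk; rewrite addn1 ltnS; case: (ltnP n m) => //; case: ltnP => //; lia.
by rewrite mxE; case: ifP => _; case: ifP => _; rewrite ?hg //; apply: h.
Qed.

(** Modulo [x ^ m] a block with [g >= m] is free of [w], and every other block has degree at most 1
    in [w]. *)
Lemma high_low_prodS m gs i j :
  high_low m (count (fun g => g < m)%N gs).+1
    ((\prod_(g <- gs) runS px pw g : 'M_2) i j).
Proof.
elim: gs i j => [|g gs IH] i j.
  rewrite big_nil -[1]/(1%:M) mxE; case: eqP => _.
    by rewrite mulr1n -polyC1; apply: high_lowC.
  by rewrite mulr0n -polyC0; apply: high_lowC.
rewrite big_cons mulr2E /=.
by apply: high_lowD; apply: high_lowM => //; apply: high_low_runS.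
Qed.

(** At [w = 1] the rows of each block sum to 1, so the product has the eigenvalue 1; the other one
    is its determinant, the product of the [(1 - x) x ^ g]. *)
Lemma trT1 gs : trT ('X : {poly rat}) 1 gs = 1 + W ^+ size gs * 'X^(sumn gs).
Proof.
suff [a [b [e1 e2]]] : exists a b, a + b - 1 = W ^+ size gs * 'X^(sumn gs) /\
    \prod_(g <- gs) runT ('X : {poly rat}) 1 g = mx2 a (1 - a) (1 - b) b.
  by rewrite /trT e2 tr2E !mx2E -e1; ring.
elim: gs => [|g gs [a [b [e1 e2]]]].
  by exists 1, 1; rewrite big_nil mx2_1 subrr /= !expr0 mulr1; split; first by ring.
exists ((1 - 'X^(g.+1)) * a + 'X^(g.+1) * (1 - b)), ((1 - 'X^g) * (1 - a) + 'X^g * b).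
split; last by rewrite big_cons e2 /runT mx2M; congr mx2; ring.
rewrite /= exprD [W ^+ _.+1]exprS.
transitivity (W * 'X^g * (a + b - 1)); last by rewrite e1; ring.
by rewrite exprS; ring.
Qed.

(** At most one gap is below [m = Z - 1], so [x ^ m] divides the coefficients of [w ^ j] for
    [j >= k]. Modulo [x ^ m] the truncated sum is therefore the full value at [w = 1], which is 1 by
    [trT1]. Its derivative vanishes below degree [m - 1], and [E_k] is read off at degree
    [Z - k - 1 < m - 1]. *)
Lemma defic_eq0 gs k : (size gs <= sumn gs)%N ->
  (count (fun g => g < size gs - 1)%N gs <= 1)%N -> (1 < k < size gs)%N ->
  defic gs k = 0.
Proof.
move=> hR hc hk; have /andP[k1 kZ] := hk.
set m := (size gs - 1)%N in hc *.
have k0 : (0 < k)%N by lia.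
have hcT j : (k <= j)%N -> low m (cT gs j).
  move=> hj; apply: (@low_WK _ _ j); rewrite mulrC cTS; apply: lowMl.
  rewrite /cS /trS tr2E coefD.
  by apply: lowD; apply: high_low_prodS; lia.
have hl : low m (lowsum k (trT px pw gs) - 1).
  pose n := maxn k (size (trT px pw gs)).
  have e : \sum_(i < n) cT gs i = 1 + W ^+ size gs * 'X^(sumn gs).
    rewrite -trT1; have := rmorph_trT (horner_eval (1 : {poly rat})) px pw gs.
    rewrite /= !horner_evalE hornerC hornerX => <-.
    rewrite (@horner_coef_wide _ n) ?leq_maxr //.
    by apply: eq_bigr => i _; rewrite expr1n mulr1.
  have -> : lowsum k (trT px pw gs) - 1 =
      W ^+ size gs * 'X^(sumn gs) - \sum_(k <= i < n) cT gs i.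
    have := e; rewrite -(big_mkord xpredT (cT gs)) (@big_cat_nat _ _ _ k) ?leq_maxl //=.
    rewrite big_mkord => e'; rewrite -[lowsum _ _]/(\sum_(i < k) cT gs i).
    by rewrite -[W ^+ _ * _](addKr 1) -e'; ring.
  apply: lowD; first by apply/lowMl/lowXn; lia.
  apply: lowN; rewrite big_nat; apply: low_sum => i /andP[hi _]; exact: hcT.
have hd : low m.-1 (lowsum k (trT px pw gs))^`().
  have -> : (lowsum k (trT px pw gs))^`() = (lowsum k (trT px pw gs) - 1)^`().
    by rewrite derivB -polyC1 derivC subr0.
  by apply: low_deriv; rewrite prednK // /m; lia.
have ho : low m.-1 (((size gs)%:R - k.-1%:R) * vS gs k - W * (vS gs k)^`()).
  by apply: (@low_WK _ _ (size gs)); rewrite vS_deriv //; apply: lowN; do 2!apply: lowMl.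
have := @defic_ode gs k; rewrite k0 kZ => /(_ isT).
rewrite ho /m; last by lia.
move/eqP; rewrite mulf_eq0 pnatr_eq0 => /orP[|/eqP//]; lia.
Qed.

(* Gap lists with E_1 = 1 *)
Local Close Scope ring_scope.

Lemma box_perm gs gs' s : perm_eq gs gs' -> box gs s = box gs' s.
Proof.
move=> h; apply/eqP; rewrite -(eqr_nat rat) -!coef_boxp.
by rewrite (boxp_perm h).
Qed.

Lemma box_rem0 gs s : 0 \in gs -> box (rem 0 gs) s = box gs s.
Proof.
move=> h0; rewrite (box_perm s (perm_to_rem h0)) /=.
by rewrite (bigD1 ord0) //= subn0 big1 ?addn0 // => i; rewrite (ord1 i) eqxx andbF.
Qed.

Lemma sumn_rem gs (g : nat) : g \in gs -> sumn (rem g gs) = sumn gs - g.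
Proof. by move=> h; rewrite (perm_sumn (perm_to_rem h)) /= addKn. Qed.

Lemma gap_weight_gt0 gs g : size gs <= sumn gs -> g \in gs -> g <= size gs - 2 ->
  0 < gap_weight gs g.
Proof.
move=> hR hg hgZ; rewrite /gap_weight hgZ muln_gt0 /=; apply: box_gt0.
by rewrite sumn_rem //; lia.
Qed.

(** Once the gap [x] exhausts the total, another gap of length at most [Z - 2] would add a positive
    weight. *)
Lemma gap_weight_rest gs x : size gs <= sumn gs -> x \in gs ->
  size gs - 1 <= gap_weight gs x ->
  \sum_(g <- gs) gap_weight gs g = size gs - 1 ->
  forall g, g \in rem x gs -> size gs - 1 <= g.
Proof.
move=> hR hx hw hN g hg; rewrite leqNgt; apply/negP => hlt.
have h1 := gap_weight_gt0 hR (mem_rem hg).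
have := hN; rewrite (big_rem x) //= (big_rem g) //=.
have : 0 < gap_weight gs g by apply: h1; lia.
lia.
Qed.

Lemma rest_unique gs x m : x \in gs -> x < m ->
  (forall g, g \in rem x gs -> m <= g) ->
  count_mem x gs = 1 /\ (forall g, g \in gs -> g != x -> m <= g).
Proof.
move=> hx xm h; split.
  rewrite (permP (perm_to_rem hx)) /= eqxx; congr (_.+1).
  apply/eqP; rewrite -leqn0 leqNgt -has_count; apply/hasPn => y hy /=.
  by have := h y hy; lia.
move=> g hg gx; apply: h.
by move: hg; rewrite (perm_mem (perm_to_rem hx)) inE (negPf gx).
Qed.

Lemma mem_rem_neq (x g : nat) gs : count_mem x gs = 1 -> g \in rem x gs -> g != x.
Proof.
move=> hx hg; apply/eqP => gx; rewrite gx -has_pred1 has_count in hg.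
have xs : x \in gs by rewrite -has_pred1 has_count hx.
by have := permP (perm_to_rem xs) (pred1 x); rewrite hx /= eqxx => -[e]; move: hg;
  rewrite lt0n; case/eqP.
Qed.

Lemma ltn_mul_bin m n : m * n < 'C(m + n, m).
Proof.
elim: m n => [|m IHm] n; first by rewrite mul0n bin0.
elim: n => [|n IHn]; first by rewrite muln0 addn0 binn.
rewrite addSn binS; have := IHm n.+1; move: IHn.
rewrite -addSnnS; set a := 'C(_, _); set b := 'C(_, _); nia.
Qed.

Definition tight (gs : seq nat) :=
  (count_mem (size gs - 2) gs = 1 /\
     forall g : nat, g \in gs -> g != size gs - 2 -> size gs - 1 <= g) \/
  [/\ size gs = 3, count_mem 0 gs = 1 & forall g : nat, g \in gs -> g != 0 -> 2 <= g].

(** Without a gap 0, a gap of positive weight must be [Z - 2], giving (i). With a gap 0 and [Z = 2]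
    this is again (i); for [Z > 2], comparing the numbers of zero and nonzero gaps leaves one
    nonzero gap or one zero gap, and the latter leads to (ii). *)
Lemma tight_of_weight gs : 1 < size gs <= sumn gs ->
  \sum_(g <- gs) gap_weight gs g = size gs - 1 ->
  tight gs \/ 2 < size gs /\ count (fun g => 0 < g) gs = 1.
Proof.
move=> /andP[hZ hR] hN; set Z := size gs in hZ hR hN *.
have le_N x : x \in gs -> gap_weight gs x <= Z - 1.
  by move=> hx; rewrite -hN (big_rem x) //= leq_addr.
have [h0|h0] := boolP (0 \in gs); last first.
  have pos g : g \in gs -> 0 < g.
    by move=> hg; rewrite lt0n; apply: contra h0 => /eqP <-.
  have /hasP[g hg wg] : has (fun g => 0 < gap_weight gs g) gs.
    apply/negPn/negP => /hasPn h; move: hN; rewrite big_seq big1 /=; first by lia.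
    by move=> g /h; lia.
  have gZ : g <= Z - 2 by move: wg; rewrite /gap_weight -/Z; case: ifP.
  (* If [g < Z - 2], the box without [g] has [Z - 1] positive sides and its slice is proper, so the
     weight is at least [(g + 1) (Z - 1) > Z - 1]. *)
  have eg : g = Z - 2.
    have := le_N g hg; rewrite /gap_weight -/Z gZ.
    have cr : count (fun g => 0 < g) (rem g gs) = Z - 1.
      have -> : Z - 1 = size (rem g gs) by rewrite size_rem // -/Z; lia.
      by apply/eqP; rewrite -all_count; apply/allP => y /mem_rem /pos.
    have := @box_ge (rem g gs) (Z - 2 - g); rewrite cr sumn_rem //.
    have := pos g hg; set b := box _ _; nia.
  left; left; rewrite -/Z -eg; apply: rest_unique => //; first by lia.
  apply: gap_weight_rest => //; rewrite /gap_weight -/Z gZ eg subnn box0; lia.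
have w0 : gap_weight gs 0 = box gs (Z - 2).
  by rewrite /gap_weight leq0n mul1n subn0 box_rem0.
have [Z2|Z3] := leqP Z 2.
  have e2 : Z - 2 = 0 by lia.
  left; left; rewrite -/Z e2; apply: rest_unique => //; first by lia.
  by apply: gap_weight_rest => //; rewrite -/Z w0 e2 box0; lia.
have hb : count (fun g => 0 < g) gs <= box gs (Z - 2) by apply: box_ge; lia.
have hpq : count_mem 0 gs + count (fun g => 0 < g) gs = Z.
  rewrite /Z -(count_predC (pred1 0)); congr (_ + _).
  by apply: eq_count => y /=; rewrite lt0n.
have q1 : 0 < count_mem 0 gs by rewrite -has_count has_pred1.
have p1 : 0 < count (fun g => 0 < g) gs.
  rewrite -has_count; apply/negPn/negP => /hasPn h.
  have : sumn gs = 0 by rewrite sumnE big_seq big1 // => y /h; lia.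
  by lia.
have hqb : count_mem 0 gs * box gs (Z - 2) <= Z - 1.
  rewrite -hN (bigID (pred1 0)) /=; apply: leq_trans (leq_addr _ _).
  rewrite (eq_bigr (fun=> box gs (Z - 2))); last by move=> i /eqP ->.
  by rewrite big_const_seq iter_addn_0 mulnC.
move: hb hpq q1 p1 hqb; set q := count_mem 0 gs; set p := count _ _; set b := box _ _.
move=> hb hpq q1 p1 hqb.
have [pe|pn] := eqVneq p 1; first by right.
(* From [p <= b] and [q b <= Z - 1 = p + q - 1] follows [(p - 1) (q - 1) <= 0]. *)
have qe : q = 1 by nia.
have hrest := @gap_weight_rest gs 0 hR h0; rewrite w0 -/Z -/b in hrest.
have {}hrest : forall g, g \in rem 0 gs -> Z - 1 <= g by apply: hrest => //; lia.
left; right.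
have bZ : b <= Z - 1 by have := le_N 0 h0; rewrite w0.
have [c1 c2] := rest_unique h0 (ltac:(lia) : 0 < Z - 1) hrest.
have eZ : Z = 3.
  move: bZ; rewrite /b -box_rem0 //.
  have : size (rem 0 gs) = Z - 1 by rewrite size_rem // -/Z; lia.
  case E : (rem 0 gs) => [|g l]; first by move=> /=; lia.
  move=> /= sl; rewrite -/(box (g :: l) _) box_large; last first.
    by rewrite -E; apply/allP => y /hrest; lia.
  move: (size l) sl => n sl; have -> : n = Z - 2 by lia.
  have [z ez] : exists z, Z = z.+3 by exists (Z - 3); lia.
  (* The slice is a central binomial coefficient, larger than [(Z - 2) ^ 2]; being at most [Z - 1],
     it leaves only [Z = 3]. *)
  have := ltn_mul_bin (Z - 2) (Z - 2); rewrite ez !subSS !subn0 /=; set c := 'C(_, _); nia.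
split; [exact: eZ | exact: c1 |].
by move=> g hg /(c2 g hg); rewrite eZ.
Qed.

Lemma weight_of_tight gs : 1 < size gs <= sumn gs -> tight gs ->
  \sum_(g <- gs) gap_weight gs g = size gs - 1 /\
  count (fun g => g < size gs - 1) gs <= 1.
Proof.
move=> /andP[hZ hR] ht.
have [x [xs hw hx hr]] : exists x : nat, [/\ x \in gs, gap_weight gs x = size gs - 1,
   count_mem x gs = 1 & forall g : nat, g \in gs -> g != x -> size gs - 1 <= g].
  case: ht => [[h1 h2]|[h1 h2 h3]].
    exists (size gs - 2); split => //; first by rewrite -has_pred1 has_count h1.
    by rewrite /gap_weight leqnn subnn box0; lia.
  exists 0; have h0 : 0 \in gs by rewrite -has_pred1 has_count h2.
  have hr : forall g : nat, g \in rem 0 gs -> 2 <= g.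
    by move=> g hg; apply: h3 (mem_rem hg) (mem_rem_neq h2 hg).
  split => //; last by rewrite h1.
  rewrite /gap_weight h1 /= mul1n.
  have : size (rem 0 gs) = 2 by rewrite size_rem // h1.
  case E : (rem 0 gs) => [|g l] //= [sl]; rewrite -/(box (g :: l) 1) box_large ?sl //.
  by rewrite -E; apply/allP => y /hr; lia.
have hrem : forall g : nat, g \in rem x gs -> size gs - 1 <= g.
  by move=> g hg; apply: hr (mem_rem hg) (mem_rem_neq hx hg).
split.
  rewrite (big_rem x) //= hw big_seq big1 ?addn0 // => g /hrem hg.
  by rewrite /gap_weight ifF //; lia.
rewrite (permP (perm_to_rem xs)) /= (_ : count _ (rem x gs) = 0) ?addn0 ?leq_b1 //.
apply/eqP; rewrite -leqn0 leqNgt -has_count; apply/hasPn => y /hrem; lia.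
Qed.

(** * Words with a single nonzero gap *)

Local Open Scope ring_scope.

Lemma geoSl (K : comNzRingType) (x : K) n : geo x n.+1 = 1 + x * geo x n.
Proof.
rewrite /geo big_ord_recl expr0 mulr_sumr; congr (_ + _).
by apply: eq_bigr => i _; rewrite exprS.
Qed.

Lemma coef_geoX n i : (i < n)%N -> (geo 'X n : {poly rat})`_i = 1.
Proof.
elim: n => // n IH; rewrite ltnS leq_eqVlt => /predU1P[->|h].
  rewrite geoS coefD coefXn eqxx /geo coef_sum big1 ?add0r // => j _.
  by rewrite coefXn gtn_eqF.
by rewrite geoS coefD coefXn ltn_eqF // addr0 IH.
Qed.

Lemma trS_one_gap (K : comNzRingType) (x w : K) a b G :
  trS x w (nseq a 0%N ++ G :: nseq b 0%N) =
  geo x G.+1 + x * geo x G * (w * geo w (a + b)) + x ^+ G * w ^+ (a + b).+1.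
Proof.
have e0 m : \prod_(g <- nseq m 0%N) runS x w g = mx2 1 (x * w * geo w m) 0 (w ^+ m).
  elim: m => [|m IH]; first by rewrite big_nil mx2_1 geo0 mulr0 expr0.
  rewrite big_cons IH /runS mx2M geoS geo0 !expr0 expr1 geoS exprS.
  by congr mx2; ring.
rewrite /trS big_cat big_cons /= trM2C -(mulrA (runS x w G)) -big_cat /= -nseqD addnC e0.
by rewrite /runS mx2M tr2E !mx2E !exprS; ring.
Qed.

(** Here [c_0 = 1 + x + ... + x ^ G] and [c_1 = x + ... + x ^ G], so [v_2] has all coefficients 1 up
    to degree [G], which covers both coefficients in [defic]. *)
Lemma defic2_one_gap a b G : (1 < a + b <= G)%N ->
  defic (nseq a 0%N ++ G :: nseq b 0%N) 2 = 1.
Proof.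
move=> /andP[ab hG]; set gs := _ ++ _.
pose n := (a + b)%N.
have sz : size gs = n.+1 by rewrite size_cat /= !size_nseq addnS.
have eg m : (geo 'X m : {poly rat})%:P = geo px m :> P2.
  exact: (rmorph_geo (@polyC {poly rat})).
have tr : trS px pw gs = (geo 'X G.+1)%:P +
    ('X * geo 'X G)%:P * (pw * geo pw n) + px ^+ G * pw ^+ n.+1.
  by rewrite trS_one_gap polyCM !eg.
have gw0 : (geo pw n)`_0 = 1.
  rewrite /n; case: (a + b)%N ab => // m _; rewrite geoSl coefD coefXM addr0.
  by rewrite -[1]polyC1 coefC.
have c0 : cS gs 0 = geo 'X G.+1.
  by rewrite /cS tr !coefD coefC coefCM coefXM exprS mulrCA coefXM mulr0 !addr0.
have c1 : cS gs 1 = 'X * geo 'X G.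
  rewrite /cS tr !coefD coefC coefCM coefXM /= gw0 mulr1 add0r exprS mulrCA coefXM /=.
  have -> : pw ^+ n = pw * pw ^+ n.-1 by rewrite -exprS prednK //; rewrite /n; lia.
  by rewrite mulrCA coefXM addr0.
have v2 : vS gs 2 = geo 'X G.+1 - 'X^(G.+1).
  rewrite !vS_rec c0 c1 {1}/vS big_ord0 mulr0 add0r geoE geoSl; ring.
have hv i : (i <= G)%N -> (vS gs 2)`_i = 1.
  by move=> hi; rewrite v2 coefB coefXn ltn_eqF // subr0 coef_geoX.
rewrite /defic sz !hv; try (rewrite /n; lia).
by ring.
Qed.

Lemma one_gap_shape gs : count (fun g => 0 < g)%N gs = 1%N ->
  exists a b, gs = nseq a 0%N ++ sumn gs :: nseq b 0%N.
Proof.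
move=> h; have /hasP[G hG G0] : has (fun g => 0 < g)%N gs by rewrite has_count h.
have zero l : count (fun g => 0 < g)%N l = 0%N -> l = nseq (size l) 0%N.
  move=> hl; apply/all_pred1P/allP => y hy /=; rewrite -leqn0 leqNgt.
  by apply/negP => y0; have : has (fun g => 0 < g)%N l by [apply/hasP; exists y];
     rewrite has_count hl.
case/splitPr: hG h => s1 s2; rewrite count_cat /= G0 => h.
exists (size s1), (size s2).
have e1 : s1 = nseq (size s1) 0%N by apply: zero; lia.
have e2 : s2 = nseq (size s2) 0%N by apply: zero; lia.
by rewrite -e1 -e2 sumn_cat /= e1 e2 !sumn_nseq !mul0n addn0.
Qed.

(** * The total deficit and the equality case *)

Lemma defic_nat gs k : (0 < k < size gs)%N -> (size gs <= sumn gs)%N ->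
  exists d : nat, defic gs k = d%:R.
Proof.
move=> hk hR; have := defic_ge0 hk hR; have /intrP[m ->] := int_defic gs k.
by rewrite ler0z; case: m => // m _; exists m.
Qed.

(** All [E_k] are natural and those with [k > 1] carry a factor 4, so a total of 1 forces [E_1 = 1]
    and [e = 0]; the second clause lets a nonzero [E_2] exclude this. *)
Lemma total_defic_nat gs : (1 < size gs <= sumn gs)%N ->
  exists2 e : nat, total_defic gs = defic gs 1 + 4 * e%:R &
    (2 < size gs)%N -> defic gs 2 != 0 -> (0 < e)%N.
Proof.
move=> /andP[hZ hR].
have [e he] : exists e : nat,
    \sum_(2 <= k < size gs) 4 ^+ (k - 2) * defic gs k = e%:R.
  have : \sum_(2 <= k < size gs) 4 ^+ (k - 2) * defic gs k \is a Num.nat.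
    rewrite big_nat; apply: rpred_sum => k hk.
    have [|d ->] := @defic_nat gs k _ hR; first by lia.
    by rewrite rpredM ?rpredX // rpred_nat.
  by move=> /natrP[e ->]; exists e.
exists e; first rewrite -he /total_defic big_ltn // expr0 mul1r mulr_sumr.
  congr (_ + _); rewrite !big_nat; apply: eq_bigr => k hk.
  by rewrite mulrA -exprS; congr (_ ^+ _ * _); lia.
move=> Z3 d2; rewrite lt0n; apply: contra d2 => /eqP e0; move: he; rewrite e0 => /eqP.
rewrite big_ltn // subnn expr0 mul1r paddr_eq0; first by case/andP.
  by apply: defic_ge0; lia.
rewrite big_nat; apply: sumr_ge0 => k hk; apply: mulr_ge0; first exact: exprn_ge0.
by apply: defic_ge0; lia.
Qed.

Lemma total_defic_eq1 gs : (1 < size gs <= sumn gs)%N ->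
  total_defic gs = 1 <-> tight gs.
Proof.
move=> h; have /andP[hZ hR] := h.
have [e he he2] := total_defic_nat h.
have Z0 : (size gs - 1)%:R != 0 :> rat by rewrite pnatr_eq0; lia.
split=> [E1|ht].
  have [d hd] := @defic_nat gs 1 hZ hR.
  have /eqP : (d + 4 * e)%:R = 1%:R :> rat by rewrite natrD natrM -hd -he E1.
  rewrite eqr_nat => /eqP hde.
  have [d1 e0] : d = 1%N /\ e = 0%N by lia.
  have hN : \sum_(g <- gs) gap_weight gs g = (size gs - 1)%N.
    by apply/eqP; rewrite -(eqr_nat rat) -defic1 // hd d1 mulr1.
  have [//|[Z3 p1]] := tight_of_weight h hN.
  (* In the remaining case [E_2 = 1] makes [e] positive and the total at least 5, a
     contradiction. *)
  have [a [b es]] := one_gap_shape p1.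
  have sz : size gs = (a + b).+1.
    by rewrite [in LHS]es size_cat /= !size_nseq addnS.
  have d2 : defic gs 2 = 1 by rewrite es defic2_one_gap //; lia.
  by have := he2 Z3; rewrite d2 oner_eq0 e0 => /(_ isT).
have [hN hc] := weight_of_tight h ht.
have d1 : defic gs 1 = 1.
  by apply: (mulfI Z0); rewrite defic1 // hN mulr1.
rewrite /total_defic big_ltn // expr0 mul1r d1 big_nat big1 ?addr0 // => k hk.
by rewrite defic_eq0 ?mulr0.
Qed.

Local Close Scope ring_scope.

Theorem theorem7p7 (k t R Z : nat)
    (hk : 2 <= k) (ht1 : 1 <= t) (htN : t < 2 ^ k - 1)
    (hR : R = ones k t) (hZ : Z = zeros k t)
    (hRZ : Z <= R) (hZ2 : 2 <= Z)
    (hS : #|S_set t k| <> 2 ^ (k - 1)) :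
  ((2%:Z ^+ (R - Z + 1) <= 2%:Z ^+ (k - 1) - #|S_set t k|%:Z)%R) /\
  ((2%:Z ^+ (k - 1) - #|S_set t k|%:Z = 2%:Z ^+ (R - Z + 1))%R <->
   (count_mem (Z - 2) (gaps k t) = 1 /\
      forall g, g \in gaps k t -> g != Z - 2 -> Z - 1 <= g) \/
   [/\ Z = 3, count_mem 0 (gaps k t) = 1
     & forall g, g \in gaps k t -> g != 0 -> 2 <= g]).
Proof.
have [gs [gsP sgs rgs cardE]] :
    exists gs : seq nat, [/\ perm_eq gs (gaps k t), size gs = Z, sumn gs = R &
      2 ^+ (k - 1) - #|S_set t k|%:R = 2 ^+ (R - Z + 1) * total_defic gs]%R.
  by rewrite hR hZ; apply: card_S_defic; rewrite -?hR -?hZ; lia.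
have hgs : 1 < size gs <= sumn gs by rewrite sgs rgs hZ2.
have [d dE] : exists d : nat, total_defic gs = d%:R%R.
  have /andP[h1 h2] := hgs; have [d hd] := @defic_nat gs 1 h1 h2.
  have [e -> _] := total_defic_nat hgs; exists (d + 4 * e).
  by rewrite hd natrD natrM.
have tightE : (d = 1) <-> tight gs.
  rewrite -(total_defic_eq1 hgs) dE; split=> [->//|/eqP].
  by rewrite pnatr_eq1 => /eqP.
have intE : (2%:Z ^+ (k - 1) - #|S_set t k|%:Z = 2%:Z ^+ (R - Z + 1) * d%:Z)%R.
  apply: (@intr_inj rat); rewrite rmorphM rmorphB !rmorphXn /=.
  by rewrite cardE dE.
(* The assumption on [|S|] rules out a zero deficit, so the natural number [d] is at least 1, which
   is the bound. *)
have d0 : d != 0.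
  apply/negP => /eqP d0; apply/hS/eqP; rewrite -eqz_nat eq_sym -subr_eq0.
  by rewrite -[X in (X - _)%R]natz natrX natz intE d0 mulr0.
have p0 : (0 < 2%:Z ^+ (R - Z + 1))%R by apply: exprn_gt0.
split; first by rewrite intE ler_peMr ?(ltW p0) //; clear -d0; lia.
rewrite intE -[X in (_ * _ = X)%R]mulr1.
rewrite (rwP eqP) (inj_eq (mulfI (lt0r_neq0 p0))) eqz_nat -(rwP eqP).
rewrite tightE /tight sgs !(permP gsP).
have mE g : (g \in gs) = (g \in gaps k t) by apply: perm_mem.
by split; (case=> [[h1 h2]|[h1 h2 h3]]; [left | right]; split => // g;
  rewrite (mE, =^~ mE); auto).
Qed.
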